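(* Let $q$ be a prime power with $2 \mid q+1$, let $m=\frac{q+1}{2}$ and assume $m\ge 4$. Let $P$ be a place of $\mathcal{F}_m$ with $P\notin\mathcal{O}$, and assume that $P$ is not $\mathbb{F}_{q^2}$-rational. Then the set of gaps at $P$ is $$G(P)=\left\{\, i+2j+kq+1 \ \middle|\ i,j,k\in\mathbb{Z}_{\ge 0},\ m-3-i-j-k\,\frac{q+1}{m}\ge 0 \,\right\}.$$
   Context: For a divisor $m$ of $q+1$, $\mathcal{F}_m=\overline{\mathbb{F}}_{q^2}(X,Y)$ is the Fermat function field defined by $X^m+Y^m+1=0$ over the algebraic closure $\overline{\mathbb{F}}_{q^2}$ of the field $\mathbb{F}_{q^2}$ with $q^2$ elements; its genus is $(m-1)(m-2)/2$. For $a,b\in\overline{\mathbb{F}}_{q^2}$ with $a^m+b^m+1=0$, $P_{(a,b)}$ denotes the common zero of $X-a$ and $Y-b$. Let $\alpha_1,\dots,\alpha_m\in\mathbb{F}_{q^2}$ be the $m$ roots of $t^m+1=0$, and let $P_\infty^1,\dots,P_\infty^m$ be the $m$ common poles of $X$ and $Y$. Set $\mathcal{O}=\{P_{(\alpha_i,0)},P_{(0,\alpha_i)},P_\infty^i \mid i=1,\dots,m\}$. Thus the places not in $\mathcal{O}$ are exactly the $P_{(a,b)}$ with $a^m+b^m+1=0$ and $ab\ne 0$. A place of $\mathcal{F}_m$ is called $\mathbb{F}_{q^2}$-rational if it can be identified with a rational (degree one) place of the function field $\mathbb{F}_{q^2}(X,Y)$ given by the same equation; for $P=P_{(a,b)}$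 this means $a,b\in\mathbb{F}_{q^2}$. For a place $P$, the Weierstrass semigroup $H(P)$ is the set of nonnegative integers $n$ for which there is a function $f\in\mathcal{F}_m$ with pole divisor $(f)_\infty=nP$, and the set of gaps is $G(P)=\mathbb{N}\setminus H(P)$. *)

(* Defs.v *)
From HB Require Import structures.
From mathcomp Require Import all_boot all_order all_algebra.
From mathcomp Require Import boolp classical_sets.
Set Implicit Arguments.
Unset Strict Implicit.
Unset Printing Implicit Defensive.
Import Order.TTheory GRing.Theory Num.Theory.
Local Open Scope classical_set_scope.
Local Open Scope ring_scope.

(* The subfield k(x, y) of L, for a subfield k of L given by an embedding i. *)
Definition subfield_gen2 (k L : fieldType) (i : {rmorphism k -> L}) (x y : L) :
    set L :=
  [set z | exists g h : {poly {poly k}},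
     (map_poly (map_poly i) h).[x, y] != 0 /\
     z = (map_poly (map_poly i) g).[x, y] / (map_poly (map_poly i) h).[x, y]].

(* K is an algebraic closure of F, embedded by i. *)
Definition algebraic_closure_of (F : fieldType) (K : closedFieldType)
    (i : {rmorphism F -> K}) : Prop :=
  forall u : K, algebraicOver i u.

(* L = K(x, y) with x transcendental over K and x^m + y^m + 1 = 0.  When the
   Fermat polynomial is irreducible over K, as it is when m is prime to the
   characteristic, this determines (L, x, y) up to a unique K-isomorphism. *)
Definition fermat_function_field (m : nat) (K L : fieldType)
    (j : {rmorphism K -> L}) (x y : L) : Prop :=
  [/\ ~ algebraicOver j x,
      x ^+ m + y ^+ m + 1 = 0 &
      subfield_gen2 j x y = setT].

Section Places.
Variables (K L : fieldType) (j : {rmorphism K -> L}).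

Definition valuation_ring (O : set L) : Prop :=
  [/\ O 1,
      forall u v, O u -> O v -> O (u - v) /\ O (u * v),
      range j `<` O,
      O `<` setT &
      forall z, O z \/ O z^-1].

Definition ring_units (O : set L) : set L :=
  [set z | O z /\ exists2 w, O w & z * w = 1].

(* A place is the maximal ideal (the set of non-units) of a valuation ring of
   L/K. *)
Record place := Place {
  place_ideal : set L;
  placeP : exists2 O, valuation_ring O & place_ideal = O `\` ring_units O
}.

(* The valuation ring of P; 0 is singled out because 0^-1 = 0. *)
Definition place_ring (P : place) : set L := [set z | z = 0 \/ ~ place_ideal P z^-1].

Definition uniformizer (P : place) (t : L) : Prop :=
  place_ideal P = [set t * w | w in place_ring P].

(* The normalized discrete valuation: v_P(t^n u) = n for a uniformizer t and
   a unit u.  It is only meaningful for z != 0 (junk value 0 at z = 0). *)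
Definition place_val (P : place) (z : L) : int :=
  xget 0 [set n : int | exists t u,
    [/\ uniformizer P t, ring_units (place_ring P) u & z = t ^ n * u]].

Definition zero_at (P : place) (z : L) : Prop := 0 < place_val P z.
Definition pole_at (P : place) (z : L) : Prop := place_val P z < 0.

(* Divisors are represented by their coefficient functions. *)
Definition pole_divisor (f : L) : place -> int :=
  fun Q => Num.max 0 (- place_val Q f).

Definition multiple_of_place (n : nat) (P : place) : place -> int :=
  fun Q => if `[< Q = P >] then n%:Z else 0.

Definition weierstrass_semigroup (P : place) : set nat :=
  [set n | exists2 f : L, f != 0 & pole_divisor f = multiple_of_place n P].

Definition gaps (P : place) : set nat := ~` weierstrass_semigroup P.

Definition common_zero (P : place) (x y : L) (a b : K) : Prop :=
  zero_at P (x - j a) /\ zero_at P (y - j b).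

Definition fermat_O (m : nat) (x y : L) : set place :=
  [set P | (exists a : K, a ^+ m + 1 = 0 /\
              (common_zero P x y a 0 \/ common_zero P x y 0 a)) \/
           (pole_at P x /\ pole_at P y)].

(* P lies over a degree one place of F(x, y)/F: every residue class at P of an
   element of F(x, y) regular at P is represented by a constant from F. *)
Definition rational_place (F : fieldType) (i : {rmorphism F -> K}) (x y : L)
    (P : place) : Prop :=
  forall z, subfield_gen2 (j \o i) x y z -> place_ring P z ->
    exists c : F, place_ideal P (z - j (i c)).

End Places.

(* Main.v *)
Require Import Defs.
From HB Require Import structures.
From mathcomp Require Import all_boot all_order all_algebra.
From mathcomp Require Import boolp classical_sets.
From mathcomp Require Import finfield separable.
From mathcomp Require Import ring zify.
Set Implicit Arguments.
Unset Strict Implicit.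
Unset Printing Implicit Defensive.
Import Order.TTheory GRing.Theory Num.Theory.
Local Open Scope classical_set_scope.
Local Open Scope ring_scope.

(** Write P = P_(a,b), U = a^m, V = b^m, A = a^q, B = b^q, so that U + V = -1,
    A a = U^2, B b = V^2, and let P' = P_(a^(q^2), b^(q^2)), which differs from P
    because P is not rational.  The curve is covered by the Hermitian curve
    u^(q+1) + v^(q+1) + 1 = 0 through x = u^2, y = v^2, and the product of the
    four conjugate Hermitian tangents above P is the conic
      C = (A x - B y)^2 - 2 (A x + B y) + 1,
    whose divisor is q P + P' - 2 D, with D the sum of the places at infinity
    ([conic_val], [conic_other_val], [conic_affine_unit],
    [conic_infinite_unit]).  Moreover C = E^2 + 4 U V T, where T is the tangent
    at P (order 2 at P, nonzero at P') and E another line through P (order 1 at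
    P); E and T are affine coordinates of the plane.

    A positive n is written k q - s with k > 0 and 0 <= s < q.  Multiplying by
    C^k identifies the functions whose only pole is P, of order n, with the
    polynomials h of degree at most 2k that have order s at P and order at least
    k at P'.  This uses that a function with poles only at infinity, of order at
    most d, is a polynomial of degree at most d ([regular_degree_le]).  The
    statement to prove becomes: n is a gap if and only if 4 k <= s.

    If 4 k <= s < q there is no such h ([gap_criterion]): replacing E^2 by
    C - 4 U V T, the polynomial h is, modulo C, a combination of monomials
    E^i T^l with i <= 1 and i + l <= 2k, which have distinct orders at P, all
    below 4k except for T^(2k); so h = c T^(2k) + C h' ([reduce_mod_conic]).  As
    h and C vanish at P' while T does not, c = 0, and h has order at least q.

    If s < 4 k there is one ([nongap_criterion]): start with T^(s/2) times a line
    through P' that passes through P exactly when s is odd, and add multiples of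
    C, which do not change the order at P, to reach order k at P'.

    The places and their valuations are obtained from explicit local parameters:
    above a point (c, d) of the curve with d != 0 every function is a power of
    x - c times a unit ([local_decomposition]), and the exchange of x and y and
    the chart (1/x, y/x) reach all the other places. *)

(** * Evaluation of bivariate polynomials *)

Section TwoVariables.
Variables (k S : fieldType) (i : {rmorphism k -> S}).
Implicit Types (a b : S) (g h : {poly {poly k}}).

Definition ev1 b : {poly k} -> S := horner_eval b \o map_poly i.
(** As in [p.[x, y]], the first point is substituted for the outer variable.
    On the curve the form [ev2 j y x g] is used, in which [g] is a polynomial
    in y with coefficients in K[x]. *)
Definition ev2 a b : {poly {poly k}} -> S :=
  horner_eval b \o horner_eval a%:P \o map_poly (map_poly i).

HB.instance Definition _ b := GRing.RMorphism.on (ev1 b).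
HB.instance Definition _ a b := GRing.RMorphism.on (ev2 a b).

Lemma ev1X b : ev1 b 'X = b.
Proof. by rewrite /ev1 /= map_polyX /horner_eval hornerX. Qed.

Lemma ev1C b c : ev1 b c%:P = i c.
Proof. by rewrite /ev1 /= map_polyC /horner_eval hornerC. Qed.

Lemma ev2X a b : ev2 a b 'X = a.
Proof. by rewrite /ev2 /= map_polyX /horner_eval hornerX hornerC. Qed.

Lemma ev2C a b p : ev2 a b p%:P = ev1 b p.
Proof. by rewrite /ev2 /= map_polyC /horner_eval hornerC. Qed.

Lemma ev1D b p r : ev1 b (p + r) = ev1 b p + ev1 b r. Proof. exact: rmorphD. Qed.

Lemma ev1M b p r : ev1 b (p * r) = ev1 b p * ev1 b r. Proof. exact: rmorphM. Qed.

Lemma ev2D a b g h : ev2 a b (g + h) = ev2 a b g + ev2 a b h.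
Proof. exact: rmorphD. Qed.

Lemma ev2M a b g h : ev2 a b (g * h) = ev2 a b g * ev2 a b h.
Proof. exact: rmorphM. Qed.

Lemma ev1N b p : ev1 b (- p) = - ev1 b p. Proof. exact: rmorphN. Qed.

Lemma ev2N a b g : ev2 a b (- g) = - ev2 a b g. Proof. exact: rmorphN. Qed.

Lemma ev1B b p r : ev1 b (p - r) = ev1 b p - ev1 b r. Proof. exact: rmorphB. Qed.

Lemma ev2B a b g h : ev2 a b (g - h) = ev2 a b g - ev2 a b h.
Proof. exact: rmorphB. Qed.

Lemma ev1_0 b : ev1 b 0 = 0. Proof. exact: rmorph0. Qed.

Lemma ev2_0 a b : ev2 a b 0 = 0. Proof. exact: rmorph0. Qed.

Lemma ev1_1 b : ev1 b 1 = 1. Proof. exact: rmorph1. Qed.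

Lemma ev2_1 a b : ev2 a b 1 = 1. Proof. exact: rmorph1. Qed.

Lemma ev1Xn b p n : ev1 b (p ^+ n) = ev1 b p ^+ n. Proof. exact: rmorphXn. Qed.

Lemma ev2Xn a b g n : ev2 a b (g ^+ n) = ev2 a b g ^+ n.
Proof. exact: rmorphXn. Qed.

Lemma ev1XsubC b c : ev1 b ('X - c%:P) = b - i c.
Proof. by rewrite ev1B ev1X ev1C. Qed.

Lemma ev2XsubC a b p : ev2 a b ('X - p%:P) = a - ev1 b p.
Proof. by rewrite ev2B ev2X ev2C. Qed.

Lemma ev1E b p : ev1 b p = \sum_(l < size p) i p`_l * b ^+ l.
Proof.
rewrite -{1}(coefK p) poly_def rmorph_sum; apply: eq_bigr => l _ /=.
by rewrite -mul_polyC rmorphM rmorphXn /= ev1X ev1C.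
Qed.

Lemma ev2E a b g : ev2 a b g = \sum_(l < size g) ev1 b g`_l * a ^+ l.
Proof.
rewrite -{1}(coefK g) poly_def rmorph_sum; apply: eq_bigr => l _ /=.
by rewrite -mul_polyC rmorphM rmorphXn /= ev2X ev2C.
Qed.

Lemma ev2_swap a b g : ev2 a b (swapXY g) = ev2 b a g.
Proof.
by rewrite /ev2 /= -(swapXY_map _ g) /horner_eval -horner2_swapXY swapXYK.
Qed.

End TwoVariables.

Lemma ev1_id (k : fieldType) (c : k) p : ev1 idfun c p = p.[c].
Proof. by rewrite /ev1 /= /horner_eval map_poly_id. Qed.

Lemma ev2_id (k : fieldType) (c d : k) g : ev2 idfun d c g = g.[d%:P].[c].
Proof.
rewrite /ev2 /= /horner_eval; congr ((_).[_]); congr ((_).[_]).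
rewrite (eq_map_poly (g := idfun)) ?map_poly_id // => p.
by rewrite map_poly_id.
Qed.

(** Two applications of the factor theorem.  The quotients have coefficients
    in k, so that residues of functions defined over a subfield can be computed
    in that subfield. *)
Lemma ev2_taylor (k S : fieldType) (i : {rmorphism k -> S}) (c d : k)
    (g : {poly {poly k}}) (x y : S) : exists g1 g2,
  ev2 i y x g = i (ev2 idfun d c g) + (y - i d) * ev2 i y x g1
                + (x - i c) * ev2 i y x g2.
Proof.
have /factor_theorem [g1 E1] : root (g - (g.[d%:P])%:P) d%:P.
  by rewrite /root hornerD hornerN hornerC subrr.
have /factor_theorem [g2 E2] : root (g.[d%:P] - (g.[d%:P].[c])%:P) c.
  by rewrite /root hornerD hornerN hornerC subrr.
exists g1, g2%:P; rewrite ev2_id.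
have {}E1 : g = g1 * ('X - d%:P%:P) + g.[d%:P]%:P by rewrite -E1 subrK.
have {}E2 : g.[d%:P] = g2 * ('X - c%:P) + (g.[d%:P].[c])%:P by rewrite -E2 subrK.
rewrite {1}E1 ev2D ev2M ev2XsubC ev2C {1}E2 ev1D ev1M ev1XsubC !ev1C ev2C.
by rewrite ![(_ - _) * _]mulrC addrC [_ + i _]addrC addrAC.
Qed.

Lemma ev2_map (k K L : fieldType) (i : {rmorphism k -> K})
    (j : {rmorphism K -> L}) x y g :
  ev2 j x y (map_poly (map_poly i) g) = ev2 (j \o i) x y g.
Proof.
rewrite /ev2 /=; congr (horner_eval _ (horner_eval _ _)).
rewrite -map_poly_comp; apply: eq_map_poly => p /=.
by rewrite map_poly_comp.
Qed.

Lemma ev2_map_id (k K : fieldType) (i : {rmorphism k -> K}) c d g :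
  ev2 idfun (i d) (i c) (map_poly (map_poly i) g) = i (ev2 idfun d c g).
Proof.
rewrite !ev2_id -(map_polyC i) /= horner_map /=.
by rewrite horner_map.
Qed.

Lemma ev1_horner (k S : fieldType) (i : {rmorphism k -> S}) b p :
  ev1 i b p = (map_poly i p).[b].
Proof. by []. Qed.

Lemma ev2_comp_id (K L : fieldType) (j : {rmorphism K -> L}) x y g :
  ev2 (j \o idfun) y x g = ev2 j y x g.
Proof. by []. Qed.

Lemma subfield_gen2E (k L : fieldType) (i : {rmorphism k -> L}) x y z :
  subfield_gen2 i x y z <->
  exists g h, ev2 i x y h != 0 /\ z = ev2 i x y g / ev2 i x y h.
Proof. by []. Qed.

Arguments ev1 : simpl never.
Arguments ev2 : simpl never.
#[global] Opaque ev1 ev2.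

(** * Roots of binomials *)

Section RootsOfBinomials.
Variables (K : closedFieldType) (m : nat).
Hypothesis mK : m%:R != 0 :> K.

Lemma exponent_gt0 : (0 < m)%N.
Proof. by case: m mK => //; rewrite eqxx. Qed.

Lemma ex_mth_root (w : K) : exists d, d ^+ m = w.
Proof.
have /closed_rootP [d] : size ('X^m - w%:P : {poly K}) != 1%N.
  by rewrite size_XnsubC ?exponent_gt0 // eqSS -lt0n exponent_gt0.
rewrite /root hornerD hornerN hornerXn hornerC subr_eq0 => /eqP.
by exists d.
Qed.

(** Since m is nonzero in K, X^m - w is separable and has m distinct roots,
    too many for a nonzero polynomial of degree less than m. *)
Lemma poly_vanishing_on_mth_roots (w : K) (e : {poly K}) :
  w != 0 -> (size e <= m)%N -> (forall d, d ^+ m = w -> e.[d] = 0) -> e = 0.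
Proof.
move=> w0 se e0; apply/eqP/contraT => en0.
pose p : {poly K} := 'X^m - w%:P.
have sp : size p = m.+1 by rewrite size_XnsubC ?exponent_gt0.
have [r pr] := closed_field_poly_normal p.
have lp : lead_coef p = 1.
  by apply/eqP; rewrite -monicE monicXnsubC ?exponent_gt0.
have ur : uniq r.
  rewrite -separable_prod_XsubC; rewrite lp scale1r in pr; rewrite -pr.
  rewrite unlock /p derivB derivC subr0 derivXn -scaler_nat coprimepZr //.
  case: (m) exponent_gt0 => // n _; rewrite exprS coprimep_sym.
  rewrite coprimep_addl_mul coprimep_expl //.
  rewrite -polyCN -[_%:P]mulr1 mul_polyC coprimepZr ?oppr_eq0 //.
  exact: coprimep1.
have sr : size r = m.
  by move: sp; rewrite pr lp scale1r size_prod_XsubC => -[].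
have /(max_poly_roots en0)/(_ ur) : all (root e) r.
  apply/allP => z zr; apply/eqP/e0.
  have /eqP : root p z by rewrite pr lp scale1r root_prod_XsubC.
  by rewrite hornerD hornerN hornerXn hornerC => /eqP; rewrite subr_eq0 => /eqP.
by rewrite sr ltnNge se.
Qed.

End RootsOfBinomials.

(** * The coordinate ring of the Fermat curve *)

Section CoordinateRing.
Variables (m : nat) (K : closedFieldType) (L : fieldType).
Variables (j : {rmorphism K -> L}) (x y : L).
Hypothesis mK : m%:R != 0 :> K.
Hypothesis ff : fermat_function_field m j x y.

Lemma fermat_eq : x ^+ m + y ^+ m + 1 = 0. Proof. by case: ff. Qed.

Lemma ev1_inj p : ev1 j x p = 0 -> p = 0.
Proof.
move=> p0; apply/eqP/contraT => pn0.
by case: ff => nx _ _; case: nx; exists p => //; apply/eqP.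
Qed.

(** The Fermat equation is an integral equation of y over K[x]. *)
Lemma ev2_integral g : integralOver (ev1 j x) (ev2 j y x g).
Proof.
have -> : ev2 j y x g = (map_poly (ev1 j x) g).[y].
  rewrite ev2E horner_coef size_map_inj_poly ?rmorph0 //.
    by apply: eq_bigr => l _; rewrite coef_map.
  by move=> p r /eqP; rewrite -subr_eq0 -ev1B => /eqP /ev1_inj /subr0_eq.
apply: integral_horner.
  by apply/integral_poly => l; rewrite coef_map; apply: integral_id.
have m0 := exponent_gt0 mK.
exists ('X^m - (- ('X^m + 1))%:P); first exact: monicXnsubC.
rewrite rmorphB /= map_polyXn map_polyC /root !hornerE /=.
rewrite ev1N ev1D ev1_1 ev1Xn ev1X.
by rewrite opprK addrCA addrA fermat_eq.
Qed.

(** If w is integral over K[x] and equal to r(x) / (x - c), clearing the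
    denominators of an integral equation of w gives an identity in K[x], as x is
    transcendental.  At c only its leading term, a power of r(c), survives. *)
Lemma XsubC_not_unit c w r : integralOver (ev1 j x) w ->
  (x - j c) * w = ev1 j x r -> r.[c] = 0.
Proof.
case=> p mp /eqP pw E.
pose n := (size p).-1.
have sp : size p = n.+1 by rewrite prednK // size_poly_gt0 monic_neq0.
pose s := \sum_(l < n.+1) p`_l * ('X - c%:P) ^+ (n - l) * r ^+ l.
have /ev1_inj s0 : ev1 j x s = 0.
  rewrite -[RHS](mulr0 ((x - j c) ^+ n)) -pw horner_coef.
  rewrite /s rmorph_sum /= -sp.
  have -> : size (map_poly (ev1 j x) p) = size p.
    by rewrite size_map_inj_poly ?rmorph0 // => u v /eqP;
       rewrite -subr_eq0 -ev1B => /eqP /ev1_inj /subr0_eq.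
  rewrite mulr_sumr; apply: eq_bigr => l _.
  rewrite coef_map /= !ev1M !ev1Xn -E ev1XsubC exprMn.
  have -> : (x - j c) ^+ n = (x - j c) ^+ (n - l) * (x - j c) ^+ l.
    by rewrite -exprD subnK // -ltnS -sp.
  by rewrite [ev1 _ _ _ * _]mulrC mulrACA.
have := congr1 (horner^~ c) s0.
rewrite horner0 /s horner_sum big_ord_recr /= subnn expr0 mulr1.
rewrite [p`_n](monicP mp) mul1r big1 ?add0r.
  by rewrite horner_exp => /eqP; rewrite expf_eq0 => /andP[_ /eqP].
move=> l _; rewrite !hornerM horner_exp hornerXsubC subrr expr0n subn_eq0.
by rewrite leqNgt ltn_ord mulr0 mul0r.
Qed.

(** Irreducibility of the Fermat polynomial over K(x), which comes from total
    ramification above a root c of X^m + 1.  A nontrivial relation g may be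
    taken nonzero modulo X - c, where it reads h(Y) Y^i0 with h(0) != 0.  As y^m
    is a multiple of x - c, some r(x) with r(c) != 0 is then a multiple of x - c
    in K[x,y], against [XsubC_not_unit]. *)
Lemma ev2_inj (g : {poly {poly K}}) : (size g <= m)%N -> ev2 j y x g = 0 -> g = 0.
Proof.
have m0 := exponent_gt0 mK.
move=> sg g0; apply/eqP/contraT => gn0.
have [c cm] := ex_mth_root mK (-1).
pose t := x - j c.
have tn0 : t != 0.
  apply/negP => /eqP t0.
  have /ev1_inj /eqP : ev1 j x ('X - c%:P) = 0 by rewrite ev1XsubC.
  by rewrite polyXsubC_eq0.
(* u is g divided by the largest possible power of X - c, with the roles of
   the two variables exchanged *)
have [u [u0 gb0 su]] : exists u, [/\ ev2 j x y u = 0, u.[c%:P] != 0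
    & size (swapXY u) = size g].
  have [n [u]] := multiplicity_XsubC (swapXY g) c%:P.
  rewrite swapXY_eq0 gn0 /= => ru Eg; exists u; split=> //.
    move/eqP: g0; rewrite -ev2_swap Eg ev2M mulf_eq0 => /orP[/eqP //|].
    by rewrite ev2Xn expf_eq0 ev2XsubC ev1C (negPf tn0) andbF.
  have Pn0 : ('X - c%:P) ^+ n != 0 :> {poly K} by rewrite expf_neq0 ?polyXsubC_eq0.
  rewrite -(swapXYK g) Eg rmorphM rmorphXn rmorphB /= swapXY_X swapXY_polyC.
  by rewrite map_polyC -rmorphB -rmorphXn /= mulrC mul_polyC size_scale.
have sgb : (size u.[c%:P] <= m)%N.
  by rewrite horner_polyC (leq_trans (size_poly _ _)) // su.
(* modulo X - c, u is h(Y) Y^i0 with h(0) != 0 *)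
have [i0 [h]] := multiplicity_XsubC u.[c%:P] 0.
rewrite gb0 subr0 /= rootE horner_coef0 => h0 Eh.
have i0m : (i0 < m)%N.
  have hn0 : h != 0 by apply: contraNneq h0 => ->; rewrite coef0.
  apply: leq_trans sgb; rewrite Eh size_mulXn // -[X in (X < _)%N]addn0.
  by rewrite ltn_add2l size_poly_gt0.
have /factor_theorem [R ER] : root (u - (u.[c%:P])%:P) c%:P.
  by rewrite /root hornerD hornerN hornerC subrr.
have /factor_theorem [e Ee] : root ('X^m + 1 : {poly K}) c.
  by rewrite /root hornerD hornerXn cm hornerC addrC subrr.
have ec0 : e.[c] != 0.
  have := congr1 (fun p => p^`().[c]) Ee.
  rewrite derivD derivXn derivC addr0 derivM derivXsubC mulr1 hornerD hornerM.
  rewrite hornerXsubC subrr mulr0 add0r hornerMn hornerXn => <-.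
  rewrite -mulr_natr mulf_neq0 // expf_neq0 //; apply: contra_eq_neq cm => ->.
  by rewrite expr0n eqn0Ngt m0 eq_sym oppr_eq0 oner_eq0.
have /factor_theorem [h1 Eh1] : root (h - (h`_0)%:P) 0.
  by rewrite /root hornerD hornerN hornerC horner_coef0 subrr.
rewrite subr0 in Eh1.
have {}Eh1 : ev1 j y h = j h`_0 + ev1 j y h1 * y.
  by rewrite -[in LHS](subrK (h`_0)%:P h) Eh1 ev1D ev1M ev1X ev1C addrC.
have {}ER : ev1 j y h * y ^+ i0 = - (ev2 j x y R * t).
  have := congr1 (ev2 j x y) ER; rewrite ev2M ev2XsubC ev1C => <-.
  by rewrite ev2B u0 sub0r opprK ev2C Eh ev1M ev1Xn ev1X.
have {}Ee : y ^+ m = - (ev1 j x e * t).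
  have := congr1 (ev1 j x) Ee; rewrite ev1M ev1XsubC => <-.
  rewrite ev1D ev1_1 ev1Xn ev1X; apply/eqP; rewrite -addr_eq0.
  by rewrite addrCA addrA fermat_eq.
pose G := swapXY R * 'X^((m - i0).-1) - swapXY h1%:P * e%:P.
(* the relation makes the unit h(0) e(c) a multiple of y *)
have E : j h`_0 * ev1 j x e = y * ev2 j y x G.
  have : ev1 j y h * ev1 j x e = ev2 j x y R * y ^+ (m - i0).
    apply: (mulIf tn0); rewrite -mulrA -[_ * t]opprK -Ee.
    rewrite -[in y ^+ m](subnKC (ltnW i0m)) exprD mulrN mulrA ER.
    by rewrite mulNr opprK mulrAC.
  rewrite Eh1 /G ev2B !ev2M ev2Xn ev2X !ev2_swap !ev2C.
  have -> : (m - i0 = (m - i0).-1.+1)%N by lia.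
  rewrite mulrDl exprS /= mulrCA => E.
  by rewrite -[LHS](addrK (ev1 j y h1 * y * ev1 j x e)) E mulrBr mulrAC [_ * y]mulrC.
have /XsubC_not_unit : integralOver (ev1 j x) (ev2 j y x (- e%:P * G ^+ m)).
  exact: ev2_integral.
move=> /(_ c ((h`_0 *: e) ^+ m)) N.
suff /N/eqP : (x - j c) * ev2 j y x (- e%:P * G ^+ m)
    = ev1 j x ((h`_0 *: e) ^+ m).
  by rewrite horner_exp hornerZ expf_eq0 m0 mulf_eq0 (negPf h0) (negPf ec0).
rewrite ev2M ev2Xn ev2N ev2C ev1Xn -mul_polyC ev1M ev1C E.
by rewrite exprMn Ee -/t !mulNr mulrN mulrA [t * _]mulrC.
Qed.
End CoordinateRing.

(** * Local parameters *)

Lemma factor_Xn_sub (k : fieldType) (m : nat) (d : k) : exists2 b : {poly k},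
  'X^m - (d ^+ m)%:P = b * ('X - d%:P) & b.[d] = d ^+ m.-1 *+ m.
Proof.
have /factor_theorem [b Eb] : root ('X^m - (d ^+ m)%:P) d.
  by rewrite /root hornerD hornerN hornerXn hornerC subrr.
exists b => //; have := congr1 (fun p => p^`().[d]) Eb.
rewrite derivB derivXn derivC subr0 derivM derivXsubC mulr1 hornerD hornerM.
by rewrite hornerXsubC subrr mulr0 add0r hornerMn hornerXn.
Qed.

Lemma ev2_horner (k L : fieldType) (i : {rmorphism k -> L}) x z g :
  (map_poly (ev1 i x) g).[z] = ev2 i z x g.
Proof.
elim/poly_ind: g => [|g p IH]; first by rewrite rmorph0 ev2_0 horner0.
rewrite rmorphD rmorphM /= map_polyX map_polyC hornerMXaddC IH.
by rewrite ev2D ev2M ev2X ev2C.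
Qed.

Lemma ev2_comp (k L : fieldType) (i : {rmorphism k -> L}) x y g h :
  ev2 i y x (g \Po h) = ev2 i (ev2 i y x h) x g.
Proof.
elim/poly_ind: g => [|g p IH]; first by rewrite comp_poly0 !ev2_0.
by rewrite comp_poly_MXaddC !ev2D !ev2M !ev2X !ev2C IH.
Qed.

Section LocalParameter.
Variables (m : nat) (K : closedFieldType) (L : fieldType).
Variables (j : {rmorphism K -> L}) (x y : L).
Hypothesis mK : m%:R != 0 :> K.
Hypothesis ff : fermat_function_field m j x y.

(** The Fermat polynomial is monic in its second variable. *)
Lemma normal_form (g : {poly {poly K}}) : exists h r : {poly {poly K}},
  g = h * ('X^m + ('X^m + 1)%:P) + r /\ (size r <= m)%N.
Proof.
have m0 := exponent_gt0 mK.
pose F : {poly {poly K}} := 'X^m + ('X^m + 1)%:P.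
have FE : F = 'X^m - (- ('X^m + 1))%:P by rewrite polyCN opprK.
have mF : F \is monic by rewrite FE monicXnsubC.
exists (Pdiv.Ring.rdivp g F), (Pdiv.Ring.rmodp g F).
split; first exact: Pdiv.RingMonic.rdivp_eq.
rewrite -ltnS -[X in (_ < X)%N](size_XnsubC (- ('X^m + 1) : {poly K}) m0).
by rewrite -FE Pdiv.Ring.ltn_rmodpN0 ?monic_neq0.
Qed.

Lemma ev2_normal_form (g : {poly {poly K}}) : exists2 r : {poly {poly K}},
  ev2 j y x r = ev2 j y x g & (size r <= m)%N.
Proof.
have [h [r [-> sr]]] := normal_form g; exists r => //.
rewrite ev2D ev2M ev2D ev2C ev1D ev1_1 ev2Xn ev1Xn ev2X ev1X.
by rewrite addrCA addrA (fermat_eq ff) mulr0 add0r.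
Qed.

(** By [ev2_inj] a polynomial that vanishes at (x, y) is a multiple of the
    Fermat polynomial, so evaluation at a point of the curve is well defined on
    K[x,y]. *)
Lemma ev2_point (c d : K) g : c ^+ m + d ^+ m + 1 = 0 ->
  ev2 j y x g = 0 -> ev2 idfun d c g = 0.
Proof.
move=> cd; have [h [r [-> sr]]] := normal_form g.
rewrite !ev2D !ev2M !ev2D !ev2C !ev1D !ev1_1 !ev2Xn !ev1Xn !ev2X !ev1X.
have -> : y ^+ m + (x ^+ m + 1) = 0 by rewrite addrCA addrA (fermat_eq ff).
have -> : d ^+ m + (c ^+ m + 1) = 0 by rewrite addrCA addrA.
rewrite !mulr0 !add0r.
by move=> /(ev2_inj mK ff sr) ->; rewrite ev2_0.
Qed.

(** Dividing an integral equation of a nonzero element by the largest possible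
    power of the unknown leaves a nonzero constant coefficient, which is a
    multiple of the element. *)
Lemma ev2_multiple g : ev2 j y x g != 0 ->
  exists w p, p != 0 /\ ev2 j y x g * ev2 j y x w = ev1 j x p.
Proof.
move=> g0; have [u mu ru] := ev2_integral mK ff g.
have [n [v]] := multiplicity_XsubC u 0.
rewrite monic_neq0 //= subr0 rootE horner_coef0 => v0 Eu.
have {ru} : ev2 j (ev2 j y x g) x v = 0.
  move: ru; rewrite rootE ev2_horner Eu ev2M ev2Xn ev2X mulf_eq0.
  by rewrite expf_eq0 (negPf g0) andbF orbF => /eqP.
have /factor_theorem [w] : root (v - (v`_0)%:P) 0.
  by rewrite /root hornerD hornerN hornerC horner_coef0 subrr.
rewrite subr0 => /eqP; rewrite subr_eq => /eqP ->.
rewrite ev2D ev2M ev2X ev2C => /eqP; rewrite addr_eq0 => /eqP E.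
exists (w \Po g), (- v`_0); rewrite oppr_eq0; split=> //.
by rewrite ev2_comp mulrC E ev1N.
Qed.

(** Where d != 0 the curve is smooth and x - c is a local parameter: y - d is
    x - c times a quotient whose denominator has the value m d^(m-1) at the
    point.  Hence a function vanishing at the point can be divided by x - c.
    This terminates because the function divides a polynomial in x
    ([ev2_multiple]).  All divisions take place over the field k in which the
    point has its coordinates. *)
Lemma local_parameter (k : fieldType) (i : {rmorphism k -> K}) (c d : k) :
    c ^+ m + d ^+ m + 1 = 0 -> d != 0 ->
  forall g : {poly {poly k}}, ev2 (j \o i) y x g != 0 ->
  exists n g' b, [/\ ev2 idfun d c g' != 0, ev2 idfun d c b != 0 &
    ev2 (j \o i) y x g * ev2 (j \o i) y x b =
    (x - j (i c)) ^+ n * ev2 (j \o i) y x g'].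
Proof.
move=> cd d0 g g0; set ji := (j \o i : {rmorphism k -> L}).
pose up := map_poly (map_poly i) : {poly {poly k}} -> {poly {poly K}}.
have upE h : ev2 ji y x h = ev2 j y x (up h) by rewrite ev2_map.
have upc h : ev2 idfun (i d) (i c) (up h) = i (ev2 idfun d c h).
  exact: ev2_map_id.
have icd : i c ^+ m + i d ^+ m + 1 = 0.
  by rewrite -!rmorphXn -rmorphD -(rmorph1 i) -rmorphD cd rmorph0.
pose t := x - j (i c).
have tn0 : t != 0.
  apply/negP => /eqP t0.
  have /(ev1_inj ff) /eqP : ev1 j x ('X - (i c)%:P) = 0 by rewrite ev1XsubC.
  by rewrite polyXsubC_eq0.
have [b Eb bd] := factor_Xn_sub m d; have [a Ea _] := factor_Xn_sub m c.
have {bd} bd : ev2 idfun d c (map_poly polyC b) != 0.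
  rewrite -swapXY_polyC ev2_swap ev2C ev1_id bd -mulr_natr.
  by rewrite mulf_neq0 ?expf_neq0 // -(fmorph_eq0 i) rmorph_nat.
have {Ea Eb} Eab : (y - j (i d)) * ev2 ji y x (map_poly polyC b)
    = - (t * ev2 ji y x a%:P).
  rewrite -swapXY_polyC ev2_swap !ev2C mulrC; apply/eqP; rewrite -addr_eq0.
  have := congr1 (ev1 ji y) Eb; have := congr1 (ev1 ji x) Ea.
  rewrite !ev1M !ev1XsubC !ev1B !ev1Xn !ev1X !ev1C [t * _]mulrC => <- <-.
  rewrite addrACA -opprD -rmorphD [y ^+ m + _]addrC [d ^+ m + _]addrC.
  rewrite -(addrK 1 (x ^+ m + _)) (fermat_eq ff) -(addrK 1 (c ^+ m + _)) cd.
  by rewrite !sub0r rmorphN rmorph1 subrr.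
have [w [p [p0 Ep]]] : exists w p, p != 0 /\
  ev2 ji y x g * ev2 j y x w = ev1 j x p by rewrite upE; apply: ev2_multiple;
    rewrite -upE.
have [e [p1]] := multiplicity_XsubC p (i c).
rewrite p0 /= => p1c Epp.
have {Epp p1c p0}: exists2 p1, ev2 idfun (i d) (i c) p1 != 0 &
    ev2 ji y x g * ev2 j y x w = t ^+ e * ev2 j y x p1.
  exists p1%:P; first by rewrite ev2C ev1_id.
  by rewrite Ep Epp ev1M ev1Xn ev1XsubC ev2C mulrC.
(* induction on the exponent of x - c in a multiple of g lying in K[x] *)
elim: e g w {p p1 Ep g0} => [|e IH] g w [p1 p1c E].
  exists 0%N, g, 1; rewrite ev2_1 ev2_1 expr0 mulr1 mul1r oner_eq0; split=> //.
  have : ev2 j y x (up g * w - p1) = 0.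
    by rewrite ev2B ev2M -upE E expr0 mul1r subrr.
  move=> /(ev2_point icd); rewrite ev2B ev2M upc.
  by apply: contra_eq_neq => ->; rewrite rmorph0 mul0r sub0r oppr_eq0.
have [gc|gc] := eqVneq (ev2 idfun d c g) 0; last first.
  by exists 0%N, g, 1; rewrite !ev2_1 expr0 mulr1 mul1r oner_eq0.
have [g1 [g2]] := ev2_taylor ji c d g x y; rewrite gc rmorph0 add0r => Eg.
pose bb := map_poly polyC b.
pose g3 := g2 * bb - a%:P * g1.
have Eg3 : ev2 ji y x g * ev2 ji y x bb = t * ev2 ji y x g3.
  rewrite Eg mulrDl mulrAC Eab /g3 ev2B !ev2M mulrBr mulNr addrC.
  by rewrite -!mulrA.
have [|n [g' [b' [g'c b'c E']]]] := IH g3 w.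
  exists (p1 * up bb); first by rewrite ev2M upc mulf_neq0 // fmorph_eq0.
  apply: (mulfI tn0); rewrite mulrA -Eg3 mulrAC E exprS ev2M upE.
  by rewrite -!mulrA.
exists n.+1, g', (bb * b'); split=> //; first by rewrite ev2M mulf_neq0.
by rewrite ev2M mulrA Eg3 -mulrA E' mulrA exprS.
Qed.

End LocalParameter.

(** * Places and valuation rings *)

Section PlaceTheory.
Variables (K L : fieldType) (j : {rmorphism K -> L}).
Implicit Types (P Q : place j) (u v z w : L).

Lemma valuation_ring_idealE (O : set L) z : valuation_ring j O ->
  (O `\` ring_units O) z <-> O z /\ (z = 0 \/ ~ O z^-1).
Proof.
move=> [O1 OBM _ _ OV].
have O0 : O 0 by rewrite -(subrr 1); case: (OBM 1 1).
split=> [[Oz nu]|[Oz zz]]; split=> //.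
- have [->|z0] := eqVneq z 0; first by left.
  by right=> Oz'; apply: nu; split=> //; exists z^-1 => //; rewrite divff.
- move=> [_ [w Ow zw]]; case: zz => [z0|nz].
    by move/eqP: zw; rewrite z0 mul0r eq_sym oner_eq0.
  have z0 : z != 0.
    by apply: contra_eq_neq zw => ->; rewrite mul0r eq_sym oner_eq0.
  by apply: nz; rewrite -[z^-1]mulr1 -zw mulKf.
Qed.

(** The ring of a place is recovered from its ideal: z is in the ring unless
    1/z is a non-unit. *)
Lemma place_ringE (O : set L) P : valuation_ring j O ->
  place_ideal P = O `\` ring_units O -> place_ring P = O.
Proof.
move=> OP PE; have [O1 OBM _ _ OV] := OP.
have O0 : O 0 by rewrite -(subrr 1); case: (OBM 1 1).
apply/seteqP; split=> z; rewrite /place_ring /=.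
  case=> [-> //|nz]; case: (OV z) => // Oz.
  apply: contrapT => nOz; apply: nz; rewrite PE; apply/valuation_ring_idealE => //.
  by split=> //; right; rewrite invrK.
move=> Oz; have [->|z0] := eqVneq z 0; first by left.
right; rewrite PE => /(valuation_ring_idealE _ OP) [_ []].
  by move/eqP; rewrite invr_eq0 (negPf z0).
by rewrite invrK.
Qed.

Lemma place_ring_valuation P : valuation_ring j (place_ring P) /\
  place_ideal P = place_ring P `\` ring_units (place_ring P).
Proof.
by have [O OP PE] := placeP P; rewrite (place_ringE OP PE).
Qed.

Lemma place_of_ring (O : set L) : valuation_ring j O ->
  exists P, place_ring P = O.
Proof.
move=> OP.
have PP : exists2 R, valuation_ring j R & O `\` ring_units O = R `\` ring_units R.
  by exists O.
by exists (Place PP); apply: place_ringE.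
Qed.

Lemma place_idealE P z :
  place_ideal P z <-> place_ring P z /\ (z = 0 \/ ~ place_ring P z^-1).
Proof.
have [Pv ->] := place_ring_valuation P; exact: valuation_ring_idealE.
Qed.

Lemma place_ext P Q : place_ideal P = place_ideal Q -> P = Q.
Proof.
case: P Q => [M MP] [N NP] /= E; case: N / E NP => NP.
by congr Place; apply: Prop_irrelevance.
Qed.

Lemma place_ring_ext P Q : place_ring P = place_ring Q -> P = Q.
Proof.
move=> E; apply: place_ext.
by rewrite !(proj2 (place_ring_valuation _)) E.
Qed.

Section OnePlace.
Variable P : place j.
Local Notation O := (place_ring P).
Local Notation M := (place_ideal P).

Lemma place_ring1 : O 1. Proof. by have [[]] := place_ring_valuation P. Qed.

Lemma place_ringB u v : O u -> O v -> O (u - v).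
Proof. by have [[_ h _ _ _] _] := place_ring_valuation P => Ou /(h u) []. Qed.

Lemma place_ringM u v : O u -> O v -> O (u * v).
Proof. by have [[_ h _ _ _] _] := place_ring_valuation P => Ou /(h u) []. Qed.

Lemma place_ring0 : O 0. Proof. by left. Qed.

Lemma place_ringN u : O u -> O (- u).
Proof. by rewrite -sub0r; apply: place_ringB; apply: place_ring0. Qed.

Lemma place_ringD u v : O u -> O v -> O (u + v).
Proof. by move=> Ou Ov; rewrite -[v]opprK; apply/place_ringB/place_ringN. Qed.

Lemma place_ringX n u : O u -> O (u ^+ n).
Proof.
by move=> Ou; elim: n => [|n IH]; rewrite ?expr0 ?exprS;
  [apply: place_ring1|apply: place_ringM].
Qed.

Lemma place_ringC c : O (j c).
Proof.
have [[_ _ [h _] _ _] _] := place_ring_valuation P.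
by apply: h; exists c.
Qed.

Lemma place_ringV z : O z \/ O z^-1.
Proof. by have [[_ _ _ _ h] _] := place_ring_valuation P. Qed.

Lemma place_ring_sum (I : Type) (r : seq I) (F : I -> L) :
  (forall i, O (F i)) -> O (\sum_(i <- r) F i).
Proof. by move=> h; apply: big_ind => //;
  [apply: place_ring0|apply: place_ringD]. Qed.

Lemma place_ideal_ring z : M z -> O z. Proof. by case/place_idealE. Qed.

Lemma place_ideal0 : M 0. Proof. by apply/place_idealE; split;
  [apply: place_ring0|left]. Qed.

Lemma place_ideal1 : ~ M 1.
Proof.
case/place_idealE => _ [/eqP|]; first by rewrite oner_eq0.
by rewrite invr1; apply; apply: place_ring1.
Qed.

Lemma place_idealMr u v : M u -> O v -> M (u * v).
Proof.
move=> Mu Ov; apply/place_idealE; split;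
  first exact: place_ringM (place_ideal_ring Mu) Ov.
have [->|v0] := eqVneq v 0; first by left; rewrite mulr0.
have [->|u0] := eqVneq u 0; first by left; rewrite mul0r.
right=> h; case/place_idealE: Mu => _ [/eqP|]; first by rewrite (negPf u0).
apply; have -> : u^-1 = (u * v)^-1 * v by rewrite invfM mulfVK.
exact: place_ringM.
Qed.

Lemma place_idealMl u v : O u -> M v -> M (u * v).
Proof. by move=> Ou Mv; rewrite mulrC; apply: place_idealMr. Qed.

Lemma place_idealN u : M u -> M (- u).
Proof. by move=> Mu; rewrite -mulrN1;
  apply: place_idealMr Mu (place_ringN place_ring1). Qed.
(** One of u/v and v/u lies in the valuation ring. *)
Lemma place_idealD u v : M u -> M v -> M (u + v).
Proof.
move=> Mu Mv.
have [->|u0] := eqVneq u 0; first by rewrite add0r.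
have [->|v0] := eqVneq v 0; first by rewrite addr0.
have [h|] := place_ringV (u / v).
  have -> : u + v = v * (u / v + 1) by rewrite mulrDr mulr1 mulrC mulfVK.
  by apply: place_idealMr => //; apply: place_ringD => //; apply: place_ring1.
rewrite invfM invrK mulrC => h.
have -> : u + v = u * (1 + v / u) by rewrite mulrDr mulr1 [v / u]mulrC mulVKf.
by apply: place_idealMr => //; apply: place_ringD => //; apply: place_ring1.
Qed.

Lemma place_idealB u v : M u -> M v -> M (u - v).
Proof. by move=> Mu Mv; apply/place_idealD/place_idealN. Qed.

Lemma place_ideal_const c : M (j c) -> c = 0.
Proof.
case/place_idealE => _ [/eqP|]; first by rewrite fmorph_eq0 => /eqP.
by rewrite -fmorphV => []; have := place_ringC c^-1.
Qed.
(** The residue of a function is unique. *)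
Lemma place_ideal_const_eq z a b : M (z - j a) -> M (z - j b) -> a = b.
Proof.
move=> Ma Mb; apply/esym/eqP; rewrite -subr_eq0; apply/eqP/place_ideal_const.
have -> : j (b - a) = (z - j a) - (z - j b).
  by rewrite rmorphB opprB [RHS]addrC addrA subrK.
exact: place_idealB.
Qed.

Lemma place_ideal_sum (I : Type) (r : seq I) (p : pred I) (F : I -> L) :
  (forall i, p i -> M (F i)) -> M (\sum_(i <- r | p i) F i).
Proof. by move=> h; apply: big_ind => //;
  [apply: place_ideal0|apply: place_idealD]. Qed.

Lemma place_idealX n u : M u -> (0 < n)%N -> M (u ^+ n).
Proof.
by case: n => // n Mu _; rewrite exprS; apply: place_idealMr => //;
  apply/place_ringX/place_ideal_ring.
Qed.

Lemma place_ring_unitV z : O z -> ~ M z -> O z^-1.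
Proof.
move=> Oz nM; apply: contrapT => nO; apply: nM; apply/place_idealE.
by split=> //; right.
Qed.

Lemma place_ring_expn n z : (0 < n)%N -> O (z ^+ n) -> O z.
Proof.
move=> n0 Ozn; have [->|z0] := eqVneq z 0; first exact: place_ring0.
case: (place_ringV z) => // Oz'; apply: contrapT => nO; apply: place_ideal1.
rewrite -(divff (expf_neq0 n z0)); apply: place_idealMl => //; rewrite -exprVn.
apply: place_idealX => //; apply/place_idealE; split=> //; right; by rewrite invrK.
Qed.

Lemma place_ideal_nonring z : ~ O z -> M z^-1.
Proof.
move=> nO; apply/place_idealE; case: (place_ringV z) => // h; split=> //.
by right; rewrite invrK.
Qed.

Lemma place_ideal_prime u v : O u -> O v -> M (u * v) -> M u \/ M v.
Proof.
move=> Ou Ov Muv; have [Mu|nMu] := pselect (M u); first by left.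
right; have u0 : u != 0 by apply: contra_not_neq nMu => ->; apply: place_ideal0.
by rewrite -(mulKf u0 v); apply: place_idealMl => //; apply: place_ring_unitV.
Qed.

Lemma place_ideal_prod (I : Type) (r : seq I) (F : I -> L) :
  (forall i, O (F i)) -> M (\prod_(i <- r) F i) -> exists i, M (F i).
Proof.
move=> OF; elim: r => [|i r IH]; first by rewrite big_nil => /place_ideal1.
rewrite big_cons => /place_ideal_prime [//||Mi|/IH //]; last by exists i.
by apply: big_ind => //; [apply: place_ring1|apply: place_ringM].
Qed.

Lemma ring_unitsE u : ring_units O u <-> [/\ O u, O u^-1 & u != 0].
Proof.
split=> [[Ou [w Ow uw]]|[Ou Ou' u0]]; last first.
  by split=> //; exists u^-1 => //; rewrite divff.
have u0 : u != 0.
  by apply: contra_eq_neq uw => ->; rewrite mul0r eq_sym oner_eq0.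
by split=> //; rewrite -[u^-1]mulr1 -uw mulKf.
Qed.

Lemma ring_unitsNM u : ring_units O u <-> O u /\ ~ M u.
Proof.
split=> [/ring_unitsE [Ou Ou' u0]|[Ou nM]].
  by split=> // /place_idealE [_ [/eqP|//]]; rewrite (negPf u0).
have u0 : u != 0 by apply: contra_not_neq nM => ->; apply: place_ideal0.
by apply/ring_unitsE; split=> //; apply: place_ring_unitV.
Qed.

End OnePlace.
End PlaceTheory.

(** * Discrete places *)

#[global] Arguments place_val : simpl never.

Section DiscretePlace.
Variables (K L : fieldType) (j : {rmorphism K -> L}).

(** Besides [uniformizer], every nonzero function is required to be a power of
    t times a unit; this is what excludes valuations of higher rank. *)
Definition discrete_at (P : place j) (t : L) := uniformizer P t /\
  forall z, z != 0 -> exists (n : int) u,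
    ring_units (place_ring P) u /\ z = t ^ n * u.

Definition discrete (P : place j) := exists t, discrete_at P t.

Section OnePlace.
Variable P : place j.
Hypothesis dP : discrete P.
Local Notation O := (place_ring P).
Local Notation M := (place_ideal P).
Local Notation v := (place_val P).
Implicit Types (t u z w : L) (n : int).

Lemma uniformizer_ideal t : uniformizer P t -> M t.
Proof. by move=> ->; exists 1; [apply: place_ring1|rewrite mulr1]. Qed.

Lemma place_ideal_neq0 : exists2 z, M z & z != 0.
Proof.
have [[_ _ _ [_ h] _] _] := place_ring_valuation P.
have [z nO] : exists z, ~ O z.
  by apply: contrapT => /forallNP H; apply: h => z _; apply: contrapT; apply: H.
exists z^-1; first exact: place_ideal_nonring.
by rewrite invr_eq0; apply: contra_not_neq nO => ->; apply: place_ring0.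
Qed.

Lemma uniformizer_neq0 t : uniformizer P t -> t != 0.
Proof.
move=> ut; apply/negP => /eqP t0; have [z Mz] := place_ideal_neq0.
by move: Mz; rewrite ut => -[w _ <-]; rewrite t0 mul0r eqxx.
Qed.

Lemma place_unit1 : ring_units O 1.
Proof. by apply/ring_unitsNM; split; [apply: place_ring1|apply: place_ideal1]. Qed.

Lemma place_unitM u w : ring_units O u -> ring_units O w -> ring_units O (u * w).
Proof.
move=> /ring_unitsE [a b c] /ring_unitsE [a' b' c']; apply/ring_unitsE.
by rewrite mulf_neq0 // invfM; split=> //; apply: place_ringM.
Qed.

Lemma place_unitV u : ring_units O u -> ring_units O u^-1.
Proof.
move=> /ring_unitsE [a b c]; apply/ring_unitsE.
by rewrite invr_eq0 invrK.
Qed.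

Lemma place_unitXz u n : ring_units O u -> ring_units O (u ^ n).
Proof.
have H (k : nat) w : ring_units O w -> ring_units O (w ^+ k).
  move=> uw; elim: k => [|k IH]; first by rewrite expr0; apply: place_unit1.
  by rewrite exprS; apply: place_unitM.
move=> uu; case: n => k; first by rewrite -exprnP; apply: H.
by rewrite NegzE -exprnN -exprVn; apply/H/place_unitV.
Qed.

Lemma uniformizer_assoc t t' : uniformizer P t -> uniformizer P t' ->
  exists2 u, ring_units O u & t' = t * u.
Proof.
move=> ut ut'; have t0 := uniformizer_neq0 ut; have t0' := uniformizer_neq0 ut'.
have := uniformizer_ideal ut'; rewrite ut => -[u Ou E].
have := uniformizer_ideal ut; rewrite ut' => -[w Ow E'].
exists u => //; split=> //; exists w => //.
by apply: (mulfI t0); rewrite mulr1 mulrA E.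
Qed.

Lemma discreteP t z : uniformizer P t -> z != 0 ->
  exists n u, ring_units O u /\ z = t ^ n * u.
Proof.
have [s [us sP]] := dP => ut /sP [n [u [uu ->]]].
have [w uw ->] := uniformizer_assoc ut us.
exists n, (w ^ n * u); split; last by rewrite exprzMl ?mulrA ?unitfE //;
  [exact: (uniformizer_neq0 ut) | by case/ring_unitsE: uw].
exact: place_unitM (place_unitXz _ uw) uu.
Qed.

Lemma Xz_unit t n : uniformizer P t -> ring_units O (t ^ n) -> n = 0.
Proof.
move=> ut; have t0 := uniformizer_neq0 ut.
wlog n0 : n / 0 <= n.
  move=> H un; have [/H/(_ un)//|/ltW n0] := leP 0 n.
  have /H : 0 <= - n by rewrite oppr_ge0.
  by rewrite -invr_expz => /(_ (place_unitV un)) /eqP; rewrite oppr_eq0 => /eqP.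
case: n n0 => // -[//|k] _; rewrite -exprnP => /ring_unitsNM [_ []].
by apply: place_idealX => //; apply: uniformizer_ideal.
Qed.

(** Two uniformizers differ by a unit factor, so the exponent depends neither
    on t nor on the decomposition. *)
Lemma place_val_eq t n u : uniformizer P t -> ring_units O u ->
  v (t ^ n * u) = n.
Proof.
move=> ut uu; rewrite /place_val.
case: xgetP => [k _ [s [w [us uw E]]]|/(_ n)]; last first.
  by case; exists t, u.
have [a ua sa] := uniformizer_assoc ut us.
have t0 := uniformizer_neq0 ut.
have /ring_unitsE [_ _ u0] := uu; have /ring_unitsE [_ _ a0] := ua.
have /ring_unitsE [_ _ w0] := uw.
apply/eqP; rewrite -subr_eq0; apply/eqP.
apply: (Xz_unit ut); rewrite expfzDr // -invr_expz.
have -> : t ^ k / t ^ n = u / w / a ^ k.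
  move: E; rewrite sa exprzMl ?unitfE // => E.
  have tk := expfz_neq0 k t0; have tn := expfz_neq0 n t0.
  have ak := expfz_neq0 k a0.
  apply: (mulIf tn); rewrite divfK //; apply: (mulIf ak); apply: (mulIf w0).
  by rewrite -E; field; rewrite w0 ak.
exact: place_unitM (place_unitM uu (place_unitV uw)) (place_unitV (place_unitXz _ ua)).
Qed.

Lemma place_valP t z : uniformizer P t -> z != 0 ->
  exists2 u, ring_units O u & z = t ^ (v z) * u.
Proof.
move=> ut /(discreteP ut) [n [u [uu ->]]].
by exists u => //; rewrite place_val_eq.
Qed.

Lemma place_valM z w : z != 0 -> w != 0 -> v (z * w) = v z + v w.
Proof.
have [t [ut _]] := dP => z0 w0.
have [a ua Ea] := place_valP ut z0; have [b ub Eb] := place_valP ut w0.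
rewrite {1}Ea {1}Eb mulrACA -expfzDr ?(uniformizer_neq0 ut) //.
by rewrite place_val_eq //; apply: place_unitM.
Qed.

Lemma place_val1 : v 1 = 0.
Proof.
have [t [ut _]] := dP.
by rewrite -[1](mulr1 (t ^ 0)) place_val_eq //; apply: place_unit1.
Qed.

Lemma place_valV z : z != 0 -> v z^-1 = - v z.
Proof.
move=> z0; have z0' : z^-1 != 0 by rewrite invr_eq0.
have := place_valM z0 z0'; rewrite divff // place_val1 => /esym/eqP.
by rewrite addrC addr_eq0 => /eqP.
Qed.

Lemma place_valX z (n : nat) : z != 0 -> v (z ^+ n) = v z *+ n.
Proof.
move=> z0; elim: n => [|n IH]; first by rewrite expr0 place_val1.
by rewrite exprS place_valM ?expf_neq0 // IH mulrS.
Qed.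

Lemma uniformizer_val t : uniformizer P t -> v t = 1.
Proof.
by move=> ut; rewrite -[t]mulr1 -{1}[t]expr1z place_val_eq //; apply: place_unit1.
Qed.

Lemma place_val_ge0 z : z != 0 -> 0 <= v z <-> O z.
Proof.
have [t [ut _]] := dP => z0; have Mt := uniformizer_ideal ut.
have [u /ring_unitsE [Ou Ou' u0] Ez] := place_valP ut z0.
split=> [v0|Oz].
  rewrite Ez; apply: place_ringM => //; move: v0; case: (v z) => // n _.
  exact/place_ringX/place_ideal_ring.
rewrite leNgt; apply/negP => v0; apply: (@place_ideal1 _ _ _ P).
have -> : 1 = t ^ (- v z) * (z * u^-1).
  have -> : z * u^-1 = t ^ v z by rewrite {1}Ez mulfK.
  by rewrite -expfzDr ?(uniformizer_neq0 ut) // addNr.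
apply: place_idealMr; last exact: place_ringM.
move: v0; case: (v z) => // n _; rewrite NegzE opprK.
exact: place_idealX.
Qed.

Lemma place_val_gt0 z : z != 0 -> 0 < v z <-> M z.
Proof.
move=> z0; have z0' : z^-1 != 0 by rewrite invr_eq0.
rewrite lt_def andbC; split=> [/andP[/(place_val_ge0 z0) Oz nv]|Mz].
  apply/place_idealE; split=> //; right=> /(place_val_ge0 z0').
  rewrite place_valV // oppr_ge0 => h; case/negP: nv.
  by rewrite eq_le h; apply/place_val_ge0.
apply/andP; split; first exact/(place_val_ge0 z0)/place_ideal_ring.
apply/negP => /eqP h; case/place_idealE: Mz => _ [/eqP|]; first
  by rewrite (negPf z0).
by apply; apply/(place_val_ge0 z0'); rewrite place_valV // h.
Qed.

Lemma place_val_unit z : z != 0 -> v z = 0 <-> O z /\ ~ M z.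
Proof.
move=> z0; split=> [h|[/(place_val_ge0 z0) h nM]].
  by split; [apply/place_val_ge0|move/(place_val_gt0 z0)]; rewrite ?h.
apply/eqP; rewrite eq_le h andbT leNgt; apply/negP.
by move/(place_val_gt0 z0).
Qed.

Lemma place_valC c : c != 0 -> v (j c) = 0.
Proof.
move=> c0; apply/place_val_unit; rewrite ?fmorph_eq0 //.
by split; [apply: place_ringC|move/place_ideal_const/eqP; rewrite (negPf c0)].
Qed.

(** The zero function counts as having infinite order, whereas [place_val]
    gives it the conventional value 0. *)
Definition ord_ge n z := z = 0 \/ n <= v z.

Lemma ord_ge0 z : ord_ge 0 z <-> O z.
Proof.
have [->|z0] := eqVneq z 0; first by split=> _; [apply: place_ring0|left].
rewrite -(place_val_ge0 z0); split=> [[/eqP|//]|]; last by right.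
by rewrite (negPf z0).
Qed.

Lemma ord_ge1 z : ord_ge 1 z <-> M z.
Proof.
have [->|z0] := eqVneq z 0; first by split=> _; [apply: place_ideal0|left].
rewrite -(place_val_gt0 z0) gtz0_ge1; split=> [[/eqP|//]|]; last by right.
by rewrite (negPf z0).
Qed.

Lemma ord_ge_val n z : z != 0 -> ord_ge n z <-> n <= v z.
Proof. by move=> z0; split=> [[/eqP|//]|]; [rewrite (negPf z0)|right]. Qed.

Lemma ord_geM n n' z w : ord_ge n z -> ord_ge n' w -> ord_ge (n + n') (z * w).
Proof.
have [->|z0] := eqVneq z 0; first by left; rewrite mul0r.
have [->|w0] := eqVneq w 0; first by left; rewrite mulr0.
rewrite !ord_ge_val ?mulf_neq0 // place_valM //; exact: lerD.
Qed.

Lemma ord_ge_div n z w : w != 0 -> ord_ge n (z / w) <-> ord_ge (n + v w) z.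
Proof.
move=> w0; have [->|z0] := eqVneq z 0.
  by rewrite mul0r; split; left.
rewrite !ord_ge_val ?mulf_neq0 ?invr_eq0 // place_valM ?invr_eq0 //.
by rewrite place_valV // lerBrDr.
Qed.

Lemma ord_geD n z w : ord_ge n z -> ord_ge n w -> ord_ge n (z + w).
Proof.
have [t [ut _]] := dP; have t0 := uniformizer_neq0 ut.
have tn := expfz_neq0 n t0.
have H s : ord_ge n s <-> O (s / t ^ n).
  rewrite -ord_ge0 ord_ge_div // add0r -[t ^ n]mulr1 place_val_eq //.
  exact: place_unit1.
by rewrite !H mulrDl; apply: place_ringD.
Qed.

Lemma ord_geN n z : ord_ge n z -> ord_ge n (- z).
Proof.
have u : ord_ge 0 (-1) by apply/ord_ge0/place_ringN/place_ring1.
by move=> h; rewrite -mulN1r -[n]add0r; apply: ord_geM.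
Qed.

Lemma ord_geB n z w : ord_ge n z -> ord_ge n w -> ord_ge n (z - w).
Proof. by move=> hz hw; apply/ord_geD/ord_geN. Qed.

Lemma ord_ge_le n n' z : n' <= n -> ord_ge n z -> ord_ge n' z.
Proof. by move=> h [->|h']; [left|right; apply: le_trans h']. Qed.

Lemma ord_geX n z (k : nat) : ord_ge n z -> ord_ge (n *+ k) (z ^+ k).
Proof.
move=> h; elim: k => [|k IH]; first by rewrite expr0; apply/ord_ge0/place_ring1.
by rewrite exprS mulrS; apply: ord_geM.
Qed.

Lemma ord_geX_ideal z (k : nat) : M z -> ord_ge k%:Z (z ^+ k).
Proof. by move=> /ord_ge1 /(ord_geX k); rewrite -mulr_natr mul1r natz. Qed.

Lemma ord_geMr n z w : O z -> ord_ge n w -> ord_ge n (z * w).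
Proof. by move=> /ord_ge0 Oz h; rewrite -[n]add0r; apply: ord_geM. Qed.

(** The term of strictly smaller order decides. *)
Lemma place_val_add z w : z != 0 -> ord_ge (v z + 1) w ->
  z + w != 0 /\ v (z + w) = v z.
Proof.
move=> z0 h.
have /ord_ge1 Mw : ord_ge 1 (w / z) by rewrite ord_ge_div // addrC.
have E : z + w = z * (1 + w / z) by rewrite mulrDr mulr1 mulrC divfK // addrC.
have n1 : ~ M (1 + w / z).
  by move=> h1; apply: (@place_ideal1 _ _ _ P); rewrite -(addrK (w / z) 1);
    apply: place_idealB.
have n0 : 1 + w / z != 0 by apply: contra_not_neq n1 => ->; apply: place_ideal0.
rewrite E mulf_neq0 // place_valM //; split=> //.
suff -> : v (1 + w / z) = 0 by rewrite addr0.
by apply/place_val_unit => //; split=> //; apply: place_ringD;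
  [apply: place_ring1|apply: place_ideal_ring].
Qed.

End OnePlace.
End DiscretePlace.

(** * Symmetries of the Fermat equation *)

Section SubfieldGen2.
Variables (k L : fieldType) (i : {rmorphism k -> L}) (x y : L).
Local Notation S := (subfield_gen2 i x y).

Lemma gen2_ev2 g : S (ev2 i x y g).
Proof. by apply/subfield_gen2E; exists g, 1; rewrite ev2_1 divr1 oner_eq0. Qed.

Lemma gen2C c : S (i c).
Proof. by have := gen2_ev2 c%:P%:P; rewrite ev2C ev1C. Qed.

Lemma gen2X : S x. Proof. by have := gen2_ev2 'X; rewrite ev2X. Qed.

Lemma gen2Y : S y. Proof. by have := gen2_ev2 'X%:P; rewrite ev2C ev1X. Qed.

Lemma gen2D u v : S u -> S v -> S (u + v).
Proof.
move=> /subfield_gen2E [g [h [h0 ->]]] /subfield_gen2E [g' [h' [h0' ->]]].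
apply/subfield_gen2E; exists (g * h' + g' * h), (h * h').
by rewrite ev2D !ev2M mulf_neq0 // addf_div.
Qed.

Lemma gen2M u v : S u -> S v -> S (u * v).
Proof.
move=> /subfield_gen2E [g [h [h0 ->]]] /subfield_gen2E [g' [h' [h0' ->]]].
apply/subfield_gen2E; exists (g * g'), (h * h').
by rewrite !ev2M mulf_neq0 // mulf_div.
Qed.

Lemma gen2V u : S u -> S u^-1.
Proof.
move=> /subfield_gen2E [g [h [h0 ->]]]; rewrite invf_div.
have [->|g0] := eqVneq (ev2 i x y g) 0; last by apply/subfield_gen2E; exists h, g.
by rewrite invr0 mulr0 -(rmorph0 i); apply: gen2C.
Qed.

Lemma gen2Xn u n : S u -> S (u ^+ n).
Proof.
move=> Su; elim: n => [|n IH]; last by rewrite exprS; apply: gen2M.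
by rewrite expr0 -(rmorph1 i); apply: gen2C.
Qed.

Lemma gen2_sum (I : Type) (r : seq I) (F : I -> L) :
  (forall l, S (F l)) -> S (\sum_(l <- r) F l).
Proof.
move=> h; apply: big_ind => //; last exact: gen2D.
by rewrite -(rmorph0 i); apply: gen2C.
Qed.

(** [subfield_gen2] is the smallest subfield that contains the constants and
    the two generators. *)
Lemma gen2_min a b : S a -> S b -> subfield_gen2 i a b `<=` S.
Proof.
move=> Sa Sb; have H g : S (ev2 i a b g).
  rewrite ev2E; apply: gen2_sum => l; apply: gen2M; last exact: gen2Xn.
  rewrite ev1E; apply: gen2_sum => r; apply: gen2M; last exact: gen2Xn.
  exact: gen2C.
move=> _ /subfield_gen2E [g [h [_ ->]]].
by apply: gen2M => //; apply: gen2V.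
Qed.

End SubfieldGen2.

Section Symmetries.
Variables (m : nat) (K : closedFieldType) (L : fieldType).
Variables (j : {rmorphism K -> L}) (x y : L).
Hypothesis mK : m%:R != 0 :> K.
Hypothesis ff : fermat_function_field m j x y.

Lemma transcendental_neq0 : x != 0.
Proof.
apply/negP => /eqP x0; case: ff => nx _ _; apply: nx; rewrite x0.
exact: algebraic0.
Qed.

Lemma fermat_swap : fermat_function_field m j y x.
Proof.
have m0 := exponent_gt0 mK.
case: ff => nx E G; split.
- move=> ay; apply: nx; apply/integral_algebraic.
  pose p := 'X^m - (- (y ^+ m + 1))%:P : {poly L}.
  apply: (@integral_root_monic _ _ j x p); first exact: monicXnsubC.
    by rewrite rootE !hornerE /= opprK addrA E.
  apply/integral_poly => l; rewrite coefB coefXn coefC.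
  apply: integral_sub; first exact: integral_nat.
  case: ifP => _; last exact: integral0.
  apply/integral_opp/integral_add; last exact: integral1.
  move/integral_algebraic: ay => ay; rewrite -[y ^+ m]hornerXn.
  apply: integral_horner => //; apply/integral_poly => r; rewrite coefXn.
  exact: integral_nat.
- by rewrite [_ + x ^+ m]addrC.
- apply/seteqP; split=> // z _; have : setT z by []; rewrite -G.
  by apply: gen2_min; [apply: gen2Y|apply: gen2X].
Qed.

(** The projective change of coordinates that exchanges the line at infinity
    with the line x = 0 preserves the Fermat curve. *)
Lemma fermat_inv : fermat_function_field m j x^-1 (y / x).
Proof.
have x0 := transcendental_neq0.
case: ff => nx E G; split.
- by move=> /algebraic_inv; rewrite invrK.
- apply: (mulIf (expf_neq0 m x0)).
  rewrite mul0r !mulrDl mul1r -!exprMn divfK // mulVf // expr1n.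
  by rewrite addrC [1 + _]addrC addrA E.
- apply/seteqP; split=> // z _; have : setT z by []; rewrite -G.
  apply: gen2_min.
    by rewrite -[X in subfield_gen2 _ _ _ X]invrK; apply/gen2V/gen2X.
  rewrite -[X in subfield_gen2 _ _ _ X](divfK x0 y).
  apply: gen2M; first exact: gen2Y.
  by rewrite -[X in subfield_gen2 _ _ _ X]invrK; apply/gen2V/gen2X.
Qed.

End Symmetries.

(** * Places above the points of the affine curve *)

(** The coordinates x and y are arguments so that the same notion serves for
    the chart (1/x, y/x), in which the places at infinity lie above points. *)
Definition centered (K L : fieldType) (j : {rmorphism K -> L}) (P : place j)
    (x y : L) (c d : K) : Prop :=
  place_ideal P (x - j c) /\ place_ideal P (y - j d).

Lemma centered_swap (K L : fieldType) (j : {rmorphism K -> L}) (P : place j)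
    x y c d : centered P x y c d -> centered P y x d c.
Proof. by case. Qed.

Section CenteredPlaces.
Variables (K L : fieldType) (j : {rmorphism K -> L}).
Variables (P : place j) (x y : L) (c d : K).
Hypothesis Pc : centered P x y c d.
Local Notation O := (place_ring P).
Local Notation M := (place_ideal P).

Lemma centered_ring : O x /\ O y.
Proof.
case: Pc => Mx My; split.
  by rewrite -(subrK (j c) x); apply: place_ringD (place_ringC _ _);
    apply: place_ideal_ring.
by rewrite -(subrK (j d) y); apply: place_ringD (place_ringC _ _);
  apply: place_ideal_ring.
Qed.

Lemma ev1_ring z p : O z -> O (ev1 j z p).
Proof.
by move=> Oz; rewrite ev1E; apply: place_ring_sum => l;
  apply/place_ringM/place_ringX => //; apply: place_ringC.
Qed.

Lemma ev2_ring g : O (ev2 j y x g).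
Proof.
have [Ox Oy] := centered_ring.
by rewrite ev2E; apply: place_ring_sum => l; apply/place_ringM/place_ringX => //;
  apply: ev1_ring.
Qed.

Lemma ev2_residue g : M (ev2 j y x g - j (ev2 idfun d c g)).
Proof.
have [g1 [g2 ->]] := ev2_taylor j c d g x y; rewrite addrC 2!addrA addNr add0r.
by case: Pc => Mx My; apply: place_idealD; apply: place_idealMr (ev2_ring _).
Qed.

Lemma ev2_unit g : ev2 idfun d c g != 0 -> ring_units O (ev2 j y x g).
Proof.
move=> g0; apply/ring_unitsNM; split; first exact: ev2_ring.
move=> h; move/eqP: g0; apply; apply: (@place_ideal_const _ _ _ P).
have -> : j (ev2 idfun d c g) = ev2 j y x g - (ev2 j y x g - j (ev2 idfun d c g)).
  by rewrite opprB addrC subrK.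
exact: place_idealB (ev2_residue g).
Qed.

Lemma centered_curve m : x ^+ m + y ^+ m + 1 = 0 -> c ^+ m + d ^+ m + 1 = 0.
Proof.
move=> E; pose g : {poly {poly K}} := ('X^m)%:P + 'X^m + 1.
have ev (k S : fieldType) (i : {rmorphism k -> S}) a b :
    ev2 i b a (('X^m)%:P + 'X^m + 1) = a ^+ m + b ^+ m + 1.
  by rewrite !ev2D ev2C ev1Xn ev1X ev2Xn ev2X ev2_1.
apply: (@place_ideal_const _ _ _ P); apply: contrapT => h.
have [/ev2_unit|] := boolP (ev2 idfun d c g != 0).
  by rewrite ev E => /ring_unitsE [_ _ /eqP].
by rewrite negbK ev => /eqP h'; apply: h; rewrite h' rmorph0; apply: place_ideal0.
Qed.

Lemma centered_uniq c' d' : centered P x y c' d' -> c = c' /\ d = d'.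
Proof.
by case: Pc => a b [a' b']; split;
  [apply: place_ideal_const_eq a a'|apply: place_ideal_const_eq b b'].
Qed.

End CenteredPlaces.

Section FermatPlaces.
Variables (m : nat) (K : closedFieldType) (L : fieldType).
Variables (j : {rmorphism K -> L}) (x y : L).
Hypothesis mK : m%:R != 0 :> K.
Hypothesis ff : fermat_function_field m j x y.

Lemma XsubC_neq0 c : x - j c != 0.
Proof.
rewrite -ev1XsubC; apply/negP => /eqP /(ev1_inj ff) /eqP.
by rewrite polyXsubC_eq0.
Qed.

(** Apply [local_parameter] to a numerator and a denominator. *)
Lemma local_decomposition (k : fieldType) (i : {rmorphism k -> K}) (c d : k) :
    c ^+ m + d ^+ m + 1 = 0 -> d != 0 ->
  forall z, subfield_gen2 (j \o i) x y z -> z != 0 ->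
  exists (n : int) g h, [/\ ev2 idfun d c g != 0, ev2 idfun d c h != 0 &
    z = (x - j (i c)) ^ n * (ev2 (j \o i) y x g / ev2 (j \o i) y x h)].
Proof.
move=> cd d0 z /subfield_gen2E [g [h [h0 ->]]].
rewrite mulf_eq0 invr_eq0 (negPf h0) orbF => g0.
rewrite -!(ev2_swap (j \o i) y x) in g0 h0 *.
have [n [g' [b [g'0 b0 Eg]]]] := local_parameter mK ff cd d0 g0.
have [n' [h' [b' [h'0 b'0 Eh]]]] := local_parameter mK ff cd d0 h0.
have H s : ev2 idfun d c s != 0 -> ev2 (j \o i) y x s != 0.
  have icd : i c ^+ m + i d ^+ m + 1 = 0.
    by rewrite -!rmorphXn -rmorphD -(rmorph1 i) -rmorphD cd rmorph0.
  apply: contra_neq; rewrite -ev2_map => /(ev2_point mK ff icd).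
  by rewrite ev2_map_id => /eqP; rewrite fmorph_eq0 => /eqP.
exists (n%:Z - n'%:Z), (g' * b'), (b * h'); split; rewrite ?ev2M ?mulf_neq0 //.
have t0 := XsubC_neq0 (i c).
rewrite expfzDr // -invr_expz -!exprnP.
apply: (mulIf h0); apply: (mulIf (H _ b0)); apply: (mulIf (H _ b'0)).
rewrite divfK // Eg.
transitivity ((x - j (i c)) ^+ n / (x - j (i c)) ^+ n' *
  (ev2 (j \o i) y x g' * ev2 (j \o i) y x b' /
   (ev2 (j \o i) y x b * ev2 (j \o i) y x h')) *
  (ev2 (j \o i) y x (swapXY h) * ev2 (j \o i) y x b') * ev2 (j \o i) y x b);
    last first.
  by rewrite -!mulrA; congr (_ * (_ * (_ * (_ * (_ * _)))));
    rewrite mulrCA mulrC !mulrA.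
rewrite Eh; field.
by rewrite !H // expf_neq0.
Qed.

Lemma local_decompositionK (c d : K) :
    c ^+ m + d ^+ m + 1 = 0 -> d != 0 ->
  forall z, z != 0 -> exists (n : int) g h,
   [/\ ev2 idfun d c g != 0, ev2 idfun d c h != 0 &
    z = (x - j c) ^ n * (ev2 j y x g / ev2 j y x h)].
Proof.
move=> cd d0 z z0.
have Sz : subfield_gen2 (j \o idfun) x y z.
  by have : setT z by []; case: ff => _ _ <-.
have [n [g [h [gc hc ->]]]] := local_decomposition cd d0 Sz z0.
by exists n, g, h; rewrite !ev2_comp_id.
Qed.

(** The local ring of the curve at the point is a valuation ring: by
    [local_decompositionK] it contains z or 1/z. *)
Lemma ex_place_unramified c d : c ^+ m + d ^+ m + 1 = 0 -> d != 0 ->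
  exists P : place j, centered P x y c d.
Proof.
move=> cd d0.
pose O : set L := [set z | exists g h : {poly {poly K}},
  ev2 idfun d c h != 0 /\ z = ev2 j y x g / ev2 j y x h].
have ev0 h : ev2 idfun d c h != 0 -> ev2 j y x h != 0.
  by apply: contra_neq; apply: (ev2_point mK ff cd).
have Oev g : O (ev2 j y x g).
  by exists g, 1; rewrite !ev2_1 divr1; split; rewrite ?oner_eq0.
have nO g : ev2 idfun d c g = 0 -> ev2 j y x g != 0 -> ~ O (ev2 j y x g)^-1.
  move=> gc g0 [g' [h [hc E]]]; have h0 := ev0 _ hc.
  have : ev2 j y x (h - g * g') = 0.
    have -> : ev2 j y x (h - g * g') = ev2 j y x h - ev2 j y x g * (ev2 j y x g)^-1 * ev2 j y x h.
      by rewrite E ev2B ev2M -mulrA divfK.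
    by rewrite divff // mul1r subrr.
  move/(ev2_point mK ff cd); rewrite ev2B ev2M gc mul0r subr0 => h0'.
  by rewrite h0' eqxx in hc.
have tc : ev2 idfun d c ('X - c%:P)%:P = 0 by rewrite ev2C ev1XsubC subrr.
have tE : ev2 j y x ('X - c%:P)%:P = x - j c by rewrite ev2C ev1XsubC.
have sc : ev2 idfun d c ('X - d%:P%:P) = 0 by rewrite ev2XsubC ev1C subrr.
have sE : ev2 j y x ('X - d%:P%:P) = y - j d by rewrite ev2XsubC ev1C.
have t0 := XsubC_neq0 c.
have [P PO] : exists P : place j, place_ring P = O.
  apply: place_of_ring; split.
  - by rewrite -(ev2_1 j y x); apply: Oev.
  - move=> _ _ [g [h [h0 ->]]] [g' [h' [h0' ->]]]; split.
      exists (g * h' - g' * h), (h * h'); rewrite ev2M mulf_neq0 //.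
      by rewrite ev2B !ev2M -mulNr addf_div ?mulNr // ev0.
    by exists (g * g'), (h * h'); rewrite !ev2M mulf_neq0 // mulf_div.
  - split=> [_ [a _ <-]|h].
      by rewrite -(ev1C j x) -(ev2C j y); apply: Oev.
    have [a _ ax] : range j x.
      by apply: h; rewrite -(ev1X j x) -(ev2C j y); apply: Oev.
    by case: ff => nx _ _; apply: nx; rewrite -ax; apply: algebraic_id.
  - split=> // h; apply: (nO _ tc); first by rewrite tE.
    exact: h.
  - move=> z; have [->|z0] := eqVneq z 0.
      by left; rewrite -(ev2_0 j y x); apply: Oev.
    have [n [g [h [gc hc ->]]]] := local_decompositionK cd d0 z0.
    case: n => n; [left|right].
      exists (('X - c%:P)%:P ^+ n * g), h; split=> //.
      by rewrite ev2M ev2Xn tE mulrA.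
    exists (('X - c%:P)%:P ^+ n.+1 * h), g; split=> //.
    by rewrite ev2M ev2Xn tE NegzE invfM invf_div -mulrA -invr_expz invrK.
exists P; split.
  by rewrite -[x - _]invrK; apply: place_ideal_nonring; rewrite PO -tE;
    apply: nO; rewrite ?tE.
have [->|s0] := eqVneq (y - j d) 0; first exact: place_ideal0.
by rewrite -[y - _]invrK; apply: place_ideal_nonring; rewrite PO -sE; apply: nO;
  rewrite ?sE.
Qed.

(** The units of the local ring of the curve stay units at P. *)
Lemma discrete_unramified (P : place j) c d : centered P x y c d -> d != 0 ->
  discrete_at P (x - j c).
Proof.
move=> Pc d0; have cd := centered_curve Pc (fermat_eq ff).
have t0 := XsubC_neq0 c; case: (Pc) => Mt _.
have D z : z != 0 -> exists (n : int) u,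
    ring_units (place_ring P) u /\ z = (x - j c) ^ n * u.
  move=> z0; have [n [g [h [gc hc ->]]]] := local_decompositionK cd d0 z0.
  exists n, (ev2 j y x g / ev2 j y x h); split=> //.
  by apply: place_unitM; [|apply: place_unitV]; apply: (ev2_unit Pc).
split=> //; apply/seteqP; split=> [z Mz|_ [w Ow <-]]; last exact: place_idealMr.
have [->|z0] := eqVneq z 0; first by exists 0; [apply: place_ring0|rewrite mulr0].
have [n [u [/ring_unitsE [Ou Ou' u0] E]]] := D z z0.
case: n E => [[|n]|n] E.
- case/place_idealE: Mz => _ [/eqP|]; first by rewrite (negPf z0).
  by rewrite E expr0z mul1r.
- exists ((x - j c) ^+ n * u); last by rewrite mulrA -exprS E.
  by apply: place_ringM => //; apply/place_ringX/place_ideal_ring.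
- case/place_idealE: Mz => _ [/eqP|]; first by rewrite (negPf z0).
  case; rewrite E invfM NegzE -invr_expz invrK; apply: place_ringM => //.
  exact/place_ringX/place_ideal_ring.
Qed.

(** A nonzero function is a power of x - c times a function that is a unit at
    every place above the point, so the sign of the exponent decides whether it
    is regular, at P and at Q alike. *)
Lemma centered_inj_unramified (P Q : place j) c d :
  centered P x y c d -> centered Q x y c d -> d != 0 -> P = Q.
Proof.
move=> Pc Qc d0; have cd := centered_curve Pc (fermat_eq ff).
apply: place_ring_ext.
suff H (P1 Q1 : place j) : centered P1 x y c d -> centered Q1 x y c d ->
    place_ring P1 `<=` place_ring Q1.
  by apply/seteqP; split; apply: H.
move=> {Pc Qc P Q} Pc Qc z Oz.
have [->|z0] := eqVneq z 0; first exact: place_ring0.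
have [n [g [h [gc hc E]]]] := local_decompositionK cd d0 z0.
have [Pu Qu] : ring_units (place_ring P1) (ev2 j y x g / ev2 j y x h) /\
               ring_units (place_ring Q1) (ev2 j y x g / ev2 j y x h).
  by split; (apply: place_unitM; [|apply: place_unitV]; apply: ev2_unit;
    eassumption).
case: Pc Qc => [Mt _] [Mt' _].
case: n E => n E; rewrite E.
  by apply: place_ringM; [apply/place_ringX/place_ideal_ring|case: Qu].
case: (@place_ideal1 _ _ _ P1).
have -> : 1 = (x - j c) ^+ n.+1 * (z * (ev2 j y x g / ev2 j y x h)^-1).
  case/ring_unitsE: Pu => _ _ u0.
  by rewrite E mulfK // NegzE -invr_expz divff // expf_neq0 // XsubC_neq0.
apply: place_idealMr; first exact: place_idealX.
by apply: place_ringM => //; case/ring_unitsE: Pu.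
Qed.

End FermatPlaces.

(** * Classification of the places *)

Section AllPlaces.
Variables (m : nat) (K : closedFieldType) (L : fieldType).
Variables (j : {rmorphism K -> L}) (x y : L).
Hypothesis mK : m%:R != 0 :> K.
Hypothesis ff : fermat_function_field m j x y.

Lemma curve_neq0 (c d : K) : c ^+ m + d ^+ m + 1 = 0 -> d = 0 -> c != 0.
Proof.
have m0 := exponent_gt0 mK.
move=> + d0; apply: contra_eq_neq => ->.
by rewrite d0 expr0n eqn0Ngt m0 !add0r oner_eq0.
Qed.

Lemma curve_swap (c d : K) : c ^+ m + d ^+ m + 1 = 0 -> d ^+ m + c ^+ m + 1 = 0.
Proof. by rewrite [d ^+ m + _]addrC. Qed.

Lemma ex_place c d : c ^+ m + d ^+ m + 1 = 0 ->
  exists P : place j, centered P x y c d.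
Proof.
move=> cd; have [d0|d0] := eqVneq d 0; last exact: ex_place_unramified ff _ _ cd d0.
have [P /centered_swap Pc] := ex_place_unramified mK (fermat_swap mK ff)
  (curve_swap cd) (curve_neq0 cd d0).
by exists P.
Qed.

Lemma centered_inj (P Q : place j) c d :
  centered P x y c d -> centered Q x y c d -> P = Q.
Proof.
move=> Pc Qc; have cd := centered_curve Pc (fermat_eq ff).
have [d0|d0] := eqVneq d 0; last exact: (centered_inj_unramified mK ff Pc Qc d0).
exact: (centered_inj_unramified mK (fermat_swap mK ff) (centered_swap Pc)
  (centered_swap Qc) (curve_neq0 cd d0)).
Qed.

Lemma centered_discrete (P : place j) c d : centered P x y c d -> discrete P.
Proof.
move=> Pc; have cd := centered_curve Pc (fermat_eq ff).
have [d0|d0] := eqVneq d 0.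
  exists (y - j d).
  exact: (discrete_unramified mK (fermat_swap mK ff) (centered_swap Pc)
    (curve_neq0 cd d0)).
exists (x - j c); exact: (discrete_unramified mK ff Pc d0).
Qed.

Lemma ring_y (P : place j) : place_ring P x -> place_ring P y.
Proof.
move=> Ox; apply: (@place_ring_expn _ _ _ P m); first exact: exponent_gt0 mK.
have -> : y ^+ m = - (x ^+ m + 1).
  by apply/eqP; rewrite -addr_eq0 addrCA addrA (fermat_eq ff).
by apply/place_ringN/place_ringD; [apply: place_ringX|apply: place_ring1].
Qed.

(** If x had no residue then x - c would be a unit at P for all c, and with it
    every nonzero polynomial in x.  As every denominator divides a polynomial
    in x, and y is regular at P too, the ring of P would be all of L. *)
Lemma centered_affine (P : place j) : place_ring P x ->
  exists c d, centered P x y c d.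
Proof.
move=> Ox; have Oy := ring_y Ox.
have [c Mc] : exists c, place_ideal P (x - j c).
  apply: contrapT => /forallNP H.
  have pU p : p != 0 -> place_ring P (ev1 j x p)^-1.
    move=> p0; have [r ->] := closed_field_poly_normal p.
    rewrite -mul_polyC ev1M ev1C invfM; apply: place_ringM.
      by rewrite -fmorphV; apply: place_ringC.
    elim: r => [|z r IH]; first by rewrite big_nil ev1_1 invr1; apply: place_ring1.
    rewrite big_cons ev1M ev1XsubC invfM; apply: place_ringM IH.
    by apply: place_ring_unitV (H z); apply: place_ringB Ox (place_ringC _ _).
  have Oev g : place_ring P (ev2 j y x g).
    rewrite ev2E; apply: place_ring_sum => l; apply/place_ringM/place_ringX => //.
    exact: ev1_ring.
  have [[_ _ _ [_ h] _] _] := place_ring_valuation P.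
  apply: h => z _; have : setT z by []; case: ff => _ _ <-.
  move=> /subfield_gen2E [g [h [h0 ->]]]; apply: place_ringM.
    by rewrite -ev2_swap; apply: Oev.
  rewrite -ev2_swap in h0 *.
  have [w [p [p0 E]]] := ev2_multiple mK ff h0.
  have w0 : ev2 j y x w != 0.
    apply: contra_neq p0 => w0; apply: (ev1_inj ff).
    by rewrite -E w0 mulr0.
  have -> : (ev2 j y x (swapXY h))^-1 = ev2 j y x w * (ev1 j x p)^-1.
    by rewrite -E invfM mulrCA divff // mulr1.
  by apply: place_ringM => //; apply: pU.
have [r Er] := closed_field_poly_normal ('X^m - (- (c ^+ m + 1))%:P : {poly K}).
have m0 := exponent_gt0 mK.
have lc : lead_coef ('X^m - (- (c ^+ m + 1))%:P : {poly K}) = 1.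
  by apply/eqP; rewrite -monicE monicXnsubC.
have : place_ideal P (\prod_(z <- r) (y - j z)).
  have -> : \prod_(z <- r) (y - j z) = ev1 j y (\prod_(z <- r) ('X - z%:P)).
    elim: r {Er} => [|z r IH]; first by rewrite !big_nil ev1_1.
    by rewrite !big_cons ev1M ev1XsubC IH.
  move: Er; rewrite lc scale1r => <-.
  rewrite ev1B ev1Xn ev1X ev1C rmorphN opprK rmorphD rmorph1 rmorphXn.
  have -> : y ^+ m + (j c ^+ m + 1) = - (x ^+ m - j c ^+ m).
    apply/eqP; rewrite -addr_eq0 addrC.
    have -> : x ^+ m - j c ^+ m + (y ^+ m + (j c ^+ m + 1)) = x ^+ m + y ^+ m + 1.
      by rewrite [y ^+ m + _]addrCA [LHS]addrA subrK addrA.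
    by rewrite (fermat_eq ff).
  rewrite subrXX; apply/place_idealN/place_idealMr => //.
  by apply: place_ring_sum => l; apply: place_ringM; apply: place_ringX => //;
    apply: place_ringC.
case/place_ideal_prod => [d|d Md]; first by apply: place_ringB => //;
  apply: place_ringC.
by exists c, d.
Qed.

End AllPlaces.

Section Classification.
Variables (m : nat) (K : closedFieldType) (L : fieldType).
Variables (j : {rmorphism K -> L}) (x y : L).
Hypothesis mK : m%:R != 0 :> K.
Hypothesis ff : fermat_function_field m j x y.

(** At a pole of x the function 1/x vanishes, and the Fermat equation of the
    chart (1/x, y/x) determines the residue of y/x up to an m-th root of unity. *)
Lemma centered_infinite (P : place j) : ~ place_ring P x ->
  exists w, w ^+ m = -1 /\ centered P x^-1 (y / x) 0 w.
Proof.
move=> nO; have ff' := fermat_inv ff; have Mx := place_ideal_nonring nO.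
have [c [d Pc]] := centered_affine mK ff' (place_ideal_ring Mx).
have c0 : 0 = c.
  by apply: (place_ideal_const_eq _ (proj1 Pc)); rewrite rmorph0 subr0.
exists d; rewrite c0; split=> //.
have := centered_curve Pc (fermat_eq ff'); rewrite -c0 expr0n.
by rewrite eqn0Ngt (exponent_gt0 mK) add0r => /eqP; rewrite addr_eq0 => /eqP.
Qed.

Lemma ex_place_infinite w : w ^+ m = -1 ->
  exists P : place j, centered P x^-1 (y / x) 0 w.
Proof.
move=> wm; apply: (ex_place mK (fermat_inv ff)).
by rewrite expr0n eqn0Ngt (exponent_gt0 mK) add0r wm addNr.
Qed.

Lemma place_discrete (P : place j) : discrete P.
Proof.
have [Ox|nOx] := pselect (place_ring P x).
  by have [c [d]] := centered_affine mK ff Ox; apply: (centered_discrete mK ff).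
have [w [_]] := centered_infinite nOx.
exact: (centered_discrete mK (fermat_inv ff)).
Qed.

(** By [local_decomposition] over F, a function of F(x, y) that is regular at P
    is a multiple of x - c or a quotient of polynomials over F whose denominator
    does not vanish at the point. *)
Lemma rational_centered (F : fieldType) (i : {rmorphism F -> K}) (P : place j)
    (c d : F) : centered P x y (i c) (i d) -> d != 0 -> rational_place i x y P.
Proof.
move=> Pc d0 z Sz Oz; have cdK := centered_curve Pc (fermat_eq ff).
have cd : c ^+ m + d ^+ m + 1 = 0.
  by apply: (fmorph_inj i); rewrite !rmorphD !rmorphXn rmorph1 rmorph0.
have [->|z0] := eqVneq z 0.
  by exists 0; rewrite !rmorph0 subr0; apply: place_ideal0.
have [n [g [h [gc hc E]]]] := local_decomposition mK ff cd d0 Sz z0.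
pose V s := ev2 (j \o i) y x s.
have resV s : place_ideal P (V s - j (i (ev2 idfun d c s))).
  by have := ev2_residue Pc (map_poly (map_poly i) s); rewrite ev2_map ev2_map_id.
have unitV' s : ev2 idfun d c s != 0 -> ring_units (place_ring P) (V s).
  move=> s0; rewrite /V -ev2_map; apply: (ev2_unit Pc).
  by rewrite ev2_map_id fmorph_eq0.
have [Og _ _] := proj1 (ring_unitsE _ _) (unitV' _ gc).
have [Oh Oh' h0] := proj1 (ring_unitsE _ _) (unitV' _ hc).
case: (Pc) => Mt _.
case: n E => [[|n]|n] E.
- exists (ev2 idfun d c g / ev2 idfun d c h); rewrite E expr0z mul1r.
  set g0 := ev2 idfun d c g in gc *; set k0 := ev2 idfun d c h in hc *.
  have k0' : j (i k0) != 0 by rewrite !fmorph_eq0.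
  have -> : V g / V h - j (i (g0 / k0)) =
    ((V g - j (i g0)) * j (i k0) - j (i g0) * (V h - j (i k0)))
      * ((V h)^-1 * j (i k0^-1)).
    by rewrite !fmorph_div !fmorphV; field; rewrite h0 k0'.
  apply: place_idealMr; last by apply: place_ringM => //; apply: place_ringC.
  by apply: place_idealB; [apply: place_idealMr|apply: place_idealMl] => //;
    apply: place_ringC.
- exists 0; rewrite !rmorph0 subr0 E; apply: place_idealMr;
  first exact: place_idealX.
  by apply: place_ringM.
- case: (@place_ideal1 _ _ _ P).
  have -> : 1 = (x - j (i c)) ^+ n.+1 * (z * (V h / V g)).
    have := XsubC_neq0 ff (i c); have [_ _ g0] :=
      proj1 (ring_unitsE _ _) (unitV' _ gc).
    rewrite E NegzE -invr_expz -exprnP => t0; rewrite -/(V g) -/(V h).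
    by field; rewrite expf_neq0 // g0 h0.
  apply: place_idealMr; first exact: place_idealX.
  apply: place_ringM => //; apply: place_ringM => //.
  by case/ring_unitsE: (unitV' _ gc).
Qed.

End Classification.

(** * Functions regular on the affine curve *)

Section RegularFunctions.
Variables (m : nat) (K : closedFieldType) (L : fieldType).
Variables (j : {rmorphism K -> L}) (x y : L).
Hypothesis mK : m%:R != 0 :> K.
Hypothesis ff : fermat_function_field m j x y.

Lemma ord_ge_sum (P : place j) (I : Type) (r : seq I) (p : pred I) (F : I -> L) n :
  (forall l, p l -> ord_ge P n (F l)) -> ord_ge P n (\sum_(l <- r | p l) F l).
Proof.
move=> h; apply: big_ind => //; first by left.
by move=> u v; apply: ord_geD; apply: place_discrete mK ff _.
Qed.

(** Above a point (c, 0), y is a uniformizer and x - c has order m.  The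
    terms g_l(x) y^l with g_l(c) != 0 have distinct orders l < m, so their sum
    has order at least m only if there are none. *)
Lemma ramified_vanishing (P : place j) c (g : {poly {poly K}}) z :
    centered P x y c 0 -> (size g <= m)%N -> place_ring P z ->
  (x - j c) * z = ev2 j y x g -> forall l, (g`_l).[c] = 0.
Proof.
move=> Pc sg Oz E; have m0 := exponent_gt0 mK.
have cm : c ^+ m = -1.
  have := centered_curve Pc (fermat_eq ff).
  by rewrite expr0n eqn0Ngt m0 addr0 => /eqP; rewrite addr_eq0 => /eqP.
have dP := place_discrete mK ff P; set v := place_val P.
have c0 : c != 0.
  by apply: contra_eq_neq cm => ->;
    rewrite expr0n eqn0Ngt m0 eq_sym oppr_eq0 oner_eq0.
have [uy _] := discrete_unramified mK (fermat_swap mK ff) (centered_swap Pc) c0.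
rewrite rmorph0 subr0 in uy.
have vy : v y = 1 by apply: uniformizer_val.
have y0 : y != 0 := uniformizer_neq0 uy.
have [e Ee ec] := factor_Xn_sub m c.
have ec0 : ev2 idfun 0 c e%:P != 0.
  rewrite ev2C ev1_id ec -mulr_natr mulf_neq0 // expf_neq0 //.
have tm : ord_ge P m%:Z (x - j c).
  have ue := ev2_unit Pc ec0; rewrite ev2C in ue.
  have /ring_unitsE [_ Oe e0] := ue.
  have -> : x - j c = - (ev1 j x e)^-1 * y ^+ m.
    apply: (mulfI e0); rewrite mulNr mulrN mulrA divff // mul1r.
    have := congr1 (ev1 j x) Ee; rewrite ev1M ev1XsubC => <-.
    rewrite ev1B ev1Xn ev1X ev1C cm rmorphN rmorph1 opprK.
    by apply/eqP; rewrite -addr_eq0 addrAC (fermat_eq ff).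
  apply: ord_geMr => //; first exact: place_ringN.
  by right; rewrite place_valX // [place_val _ _]vy -mulr_natr mul1r natz.
have gm : ord_ge P m%:Z (ev2 j y x g) by rewrite -E mulrC; apply: ord_geMr.
have vanish p : p.[c] = 0 -> ord_ge P m%:Z (ev1 j x p).
  move=> /eqP /factor_theorem [p1 ->]; rewrite ev1M ev1XsubC.
  by apply: ord_geMr => //; apply: ev1_ring; case: (centered_ring Pc).
have yX r : ord_ge P r%:Z (y ^+ r).
  by right; rewrite place_valX // [place_val _ _]vy -mulr_natr mul1r natz.
move=> l; have [n ln] := ubnP l; elim: n l ln => // n IH l ln.
have [lm|ml] := ltnP l (size g); last by rewrite nth_default // horner0.
have lm' := leq_trans lm sg.
have Ml : ord_ge P (l.+1)%:Z (ev1 j x g`_l * y ^+ l).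
  move: gm; rewrite ev2E (bigD1 (Ordinal lm)) //= => gm.
  rewrite -[_ * y ^+ l](addrK (\sum_(i < size g | i != Ordinal lm) ev1 j x g`_i * y ^+ i)).
  apply: ord_geB => //; first by apply: ord_ge_le gm; rewrite lez_nat.
  apply: ord_ge_sum => i; rewrite -val_eqE /= neq_ltn => /orP[il|li].
    rewrite -[_%:Z]addr0; apply: ord_geM => //; last first.
      exact: ord_ge_le (yX i).
    apply: ord_ge_le (vanish _ _); first by rewrite lez_nat.
    by apply: IH; apply: leq_trans il _.
  apply: ord_geMr => //; first by apply: ev1_ring; case: (centered_ring Pc).
  by apply: ord_ge_le (yX i); rewrite lez_nat.
have : ord_ge P 1 (ev1 j x g`_l * y ^+ l / y ^+ l).
  apply/ord_ge_div; rewrite ?expf_neq0 //.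
  by rewrite place_valX // [place_val _ _]vy -mulr_natr mul1r natz -intS.
rewrite mulfK ?expf_neq0 // => /(ord_ge1 dP) M1.
apply: (@place_ideal_const _ _ _ P); have := ev2_residue Pc (g`_l)%:P.
rewrite !ev2C ev1_id => M2.
have -> : j (g`_l).[c] = ev1 j x g`_l - (ev1 j x g`_l - j (g`_l).[c]).
  by rewrite opprB addrC subrK.
exact: place_idealB.
Qed.

Definition affine_regular z :=
  forall (P : place j) c d, centered P x y c d -> place_ring P z.

(** It suffices that all coefficients of g vanish at c.  If c^m != -1 there are
    m places above c, and g(c, Y), of degree less than m, vanishes at their m
    ordinates; if c^m = -1 this is [ramified_vanishing]. *)
Lemma regular_step c z g : affine_regular z ->
  (x - j c) * z = ev2 j y x g -> exists g', z = ev2 j y x g'.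
Proof.
move=> Rz; have [g1 <- sg] := ev2_normal_form mK ff g => {g} E.
have m0 := exponent_gt0 mK.
suff gc0 : (swapXY g1).[c%:P] = 0.
  have /factor_theorem [h Eh] : root (swapXY g1) c%:P by apply/eqP.
  exists (swapXY h); apply: (mulfI (XsubC_neq0 ff c)).
  by rewrite E -[in LHS]ev2_swap Eh ev2M ev2XsubC ev1C ev2_swap mulrC.
have [w0|w0] := eqVneq (- (c ^+ m + 1)) 0.
  have [|P Pc] := ex_place mK ff (c := c) (d := 0).
    rewrite expr0n eqn0Ngt m0 addr0; apply/eqP.
    by rewrite -oppr_eq0 w0.
  have := ramified_vanishing Pc sg (Rz _ _ _ Pc) E.
  move=> h; apply/polyP => l;
    rewrite coef0 horner_swapXY coef_map_id0 /horner_eval ?horner0 //.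
apply: (poly_vanishing_on_mth_roots mK w0).
  by rewrite horner_swapXY (leq_trans (size_poly _ _)).
move=> d dm; rewrite horner2_swapXY -ev2_id.
have [|P Pc] := ex_place mK ff (c := c) (d := d).
  by rewrite dm addrAC subrr.
apply: (@place_ideal_const _ _ _ P).
have -> : j (ev2 idfun d c g1) = ev2 j y x g1 - (ev2 j y x g1 - j (ev2 idfun d c g1)).
  by rewrite opprB addrC subrK.
apply: place_idealB (ev2_residue Pc _); rewrite -E.
by apply: place_idealMr (Rz _ _ _ Pc); case: Pc.
Qed.

(** The function has a denominator in K[x], whose linear factors are removed
    one by one. *)
Lemma regular_poly z : affine_regular z -> exists g, z = ev2 j y x g.
Proof.
move=> Rz; have : setT z by []; case: (ff) => _ _ <-.
move=> /subfield_gen2E [g [h [h0 Ez]]]; rewrite -!(ev2_swap j y x) in h0 Ez.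
have [w [p [p0 Ep]]] := ev2_multiple mK ff h0.
have {g h h0 w Ez Ep} [g E] : exists g, ev1 j x p * z = ev2 j y x g.
  exists (swapXY g * w); rewrite ev2M Ez -Ep; field; exact: h0.
have [r Er] := closed_field_poly_normal p.
have lp : lead_coef p != 0 by rewrite lead_coef_eq0.
rewrite [in ev1 _ _ p]Er in E; move: lp E {Er p0}.
move: (lead_coef p) => a a0.
elim: r z g Rz => [|c r IH] z g Rz.
  rewrite big_nil -mul_polyC mulr1 ev1C => E.
  exists ((a^-1)%:P%:P * g); rewrite ev2M ev2C ev1C -E fmorphV mulKf //.
  by rewrite fmorph_eq0.
rewrite big_cons -mul_polyC !ev1M ev1C ev1XsubC => E.
have [||g' E'] := IH ((x - j c) * z) g.
- move=> P c' d' Pc; apply: place_ringM; last exact: Rz Pc.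
  by apply: place_ringB (place_ringC _ _); case: (centered_ring Pc).
- rewrite -E -mul_polyC ev1M ev1C -!mulrA; congr (_ * _).
  by rewrite mulrCA.
exact: regular_step Rz E'.
Qed.

Lemma ev1_infinite (P : place j) n (p : {poly K}) : place_ideal P x^-1 ->
  (size p <= n.+1)%N ->
  place_ideal P (ev1 j x p / x ^+ n - j p`_n).
Proof.
move=> Mx sp; have x0 := transcendental_neq0 ff.
rewrite ev1_horner (horner_coef_wide _ (n := n.+1)) ?size_map_poly //.
rewrite big_ord_recr /= mulrDl coef_map mulfK ?expf_neq0 // addrK mulr_suml.
apply: place_ideal_sum => l _; rewrite coef_map -mulrA; apply: place_idealMl;
  first exact: place_ringC.
have -> : x ^+ l / x ^+ n = x^-1 ^+ (n - l) by rewrite -invf_div -expfB // exprVn.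
by apply: place_idealX; rewrite // subn_gt0.
Qed.

Definition infinity_regular d z :=
  forall (P : place j) w, centered P x^-1 (y / x) 0 w -> place_ring P (z / x ^+ d).

(** Descending induction on a bound N > d for the total degree of g.  At the
    infinite place where y/x has the value w, z / x^N vanishes, and its value is
    that of the degree N part of g at (1, w).  This part has degree less than m
    in w and m zeros, so it is zero. *)
Lemma degree_bound d (g : {poly {poly K}}) : (size g <= m)%N ->
  infinity_regular d (ev2 j y x g) ->
  forall l r, (d < l + r)%N -> g`_l`_r = 0.
Proof.
move=> sg Rz; have x0 := transcendental_neq0 ff.
have [N HN] : exists N, forall l r, (N < l + r)%N -> g`_l`_r = 0.
  exists (m + sizeY g)%N => l r; have [lm|ml] := leqP m l.
    by rewrite [g`_l]nth_default ?coef0 // (leq_trans sg).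
  move=> h; apply: nth_default; apply: leq_trans (max_size_coefXY g l) _.
  by rewrite leqNgt; apply/negP => h'; move: h;
    rewrite ltnNge ltnW // -addnS leq_add // ltnW.
have [Nd|] := leqP N d.
  by move=> l r lr; apply: HN; apply: leq_ltn_trans lr.
move=> dN; rewrite -(subnK (ltnW dN)) in HN.
elim: (N - d)%N HN => {N dN} [//|n IH] HN.
apply: IH; set N := (n.+1 + d)%N in HN.
pose e : {poly K} := \poly_(l < m) (if (l <= N)%N then g`_l`_(N - l) else 0).
suff e0 : e = 0.
  move=> l r; rewrite leq_eqVlt => /orP[/eqP E|]; last exact: HN.
  have lN : (l <= N)%N by rewrite /N addSn E leq_addr.
  have -> : r = (N - l)%N by rewrite /N addSn E addKn.
  have [ml|lm] := leqP m l.
    by rewrite [g`_l]nth_default ?coef0 // (leq_trans sg).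
  by have := congr1 (fun p : {poly K} => p`_l) e0; rewrite coef_poly lm lN coef0.
have w0 : -1 != 0 :> K by rewrite oppr_eq0 oner_eq0.
apply: (poly_vanishing_on_mth_roots mK w0); first exact: size_poly.
move=> w wm; have [P Pc] := ex_place_infinite mK ff wm.
have [Mx My] := Pc; rewrite rmorph0 subr0 in Mx.
have Oy' : place_ring P (y / x) by case: (centered_ring Pc).
have M1 : place_ideal P (ev2 j y x g / x ^+ N - ev1 j (y / x) e).
  rewrite ev2E (big_ord_widen _ (fun l => ev1 j x g`_l * y ^+ l) sg) big_mkcond /=.
  rewrite ev1_horner (horner_coef_wide _ (n := m)); last first.
    by rewrite size_map_poly size_poly.
  rewrite mulr_suml -sumrB; apply: place_ideal_sum => l _.
  rewrite coef_map /= coef_poly ltn_ord.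
  have -> : (if (l < size g)%N then ev1 j x g`_l * y ^+ l else 0) = ev1 j x g`_l * y ^+ l.
    by case: ltnP => // h; rewrite nth_default // ev1_0 mul0r.
  case: leqP => lN; last first.
    have -> : g`_l = 0.
      by apply/polyP => r; rewrite coef0; apply: HN;
        apply: leq_trans lN (leq_addr _ _).
    by rewrite ev1_0 rmorph0 !mul0r subr0; apply: place_ideal0.
  have -> : ev1 j x g`_l * y ^+ l / x ^+ N - j g`_l`_(N - l) * (y / x) ^+ l
    = (ev1 j x g`_l / x ^+ (N - l) - j g`_l`_(N - l)) * (y / x) ^+ l.
    rewrite mulrBl; congr (_ - _); rewrite -{1}(subnK lN) exprD expr_div_n.
    by rewrite invfM mulrACA.
  apply: place_idealMr; last exact: place_ringX.
  apply: ev1_infinite => //; apply/leq_sizeP => r h; apply: HN.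
  by rewrite -(subnKC lN) -addnS leq_add2l.
have M2 : place_ideal P (ev2 j y x g / x ^+ N).
  have -> : ev2 j y x g / x ^+ N = ev2 j y x g / x ^+ d * x^-1 ^+ n.+1.
    by rewrite -mulrA exprVn -invfM -exprD addnC.
  by apply: place_idealMl; [apply: Rz Pc|apply: place_idealX].
apply: (@place_ideal_const _ _ _ P).
have M3 : place_ideal P (ev1 j (y / x) e - j e.[w]).
  by have := ev2_residue (centered_swap Pc) e%:P; rewrite !ev2C ev1_id.
have -> : j e.[w] = ev2 j y x g / x ^+ N - (ev2 j y x g / x ^+ N - ev1 j (y / x) e)
   - (ev1 j (y / x) e - j e.[w]).
  by rewrite opprB addrCA subrr addr0 opprB addrC subrK.
exact: place_idealB (place_idealB M2 M1) M3.
Qed.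

End RegularFunctions.

(** * The degree filtration *)

Section DegreeLe.
Variables (K L : fieldType) (j : {rmorphism K -> L}).

(** A polynomial of degree at most d + 1 is c + s z1 + t z2 with z1 and z2 of
    degree at most d.  This recursive form makes affine changes of coordinates
    immediate and does not refer to coefficients, which are not unique for
    functions on the curve. *)
Fixpoint degree_le (s t : L) (d : nat) (z : L) : Prop :=
  if d is d'.+1 then exists c z1 z2,
    [/\ degree_le s t d' z1, degree_le s t d' z2 & z = j c + s * z1 + t * z2]
  else exists c, z = j c.

Lemma degree_leC s t d c : degree_le s t d (j c).
Proof.
elim: d c => [|d IH] c; first by exists c.
by exists c, (j 0), (j 0); split; rewrite // rmorph0 !mulr0 !addr0.
Qed.

Lemma degree_leD s t d z w :
  degree_le s t d z -> degree_le s t d w -> degree_le s t d (z + w).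
Proof.
elim: d z w => [|d IH] z w /=.
  by move=> [a ->] [b ->]; exists (a + b); rewrite rmorphD.
move=> [a [z1 [z2 [h1 h2 ->]]]] [b [w1 [w2 [k1 k2 ->]]]].
exists (a + b), (z1 + w1), (z2 + w2); split; [exact: IH|exact: IH|].
by rewrite rmorphD !mulrDr; ring.
Qed.

Lemma degree_leZ s t d a z : degree_le s t d z -> degree_le s t d (j a * z).
Proof.
elim: d z => [|d IH] z /=; first by move=> [b ->]; exists (a * b); rewrite rmorphM.
move=> [b [z1 [z2 [h1 h2 ->]]]].
exists (a * b), (j a * z1), (j a * z2); split; [exact: IH|exact: IH|].
by rewrite rmorphM !mulrDr; congr (_ + _ + _); rewrite mulrCA.
Qed.

Lemma degree_le_mono s t d d' z : (d <= d')%N ->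
  degree_le s t d z -> degree_le s t d' z.
Proof.
move=> /subnK <-; elim: (d' - d)%N => // n IH h.
rewrite addSn; move: {h IH}(IH h); move: (n + d)%N => {}d.
elim: d z => [|d IHd] z; first by case=> c ->; apply: degree_leC.
move=> [c [z1 [z2 [h1 h2 ->]]]]; exists c, z1, z2; split=> //; exact: IHd.
Qed.

Lemma degree_leMs s t d z : degree_le s t d z -> degree_le s t d.+1 (s * z).
Proof.
move=> h; exists 0, z, (j 0); split=> //; first exact: degree_leC.
by rewrite rmorph0 mulr0 addr0 add0r.
Qed.

Lemma degree_leMt s t d z : degree_le s t d z -> degree_le s t d.+1 (t * z).
Proof.
move=> h; exists 0, (j 0), z; split=> //; first exact: degree_leC.
by rewrite rmorph0 mulr0 addr0 add0r.
Qed.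

Lemma degree_leM s t d e z w : degree_le s t d z -> degree_le s t e w ->
  degree_le s t (d + e) (z * w).
Proof.
move=> + hw; elim: d z => [|d IH] z; first by case=> c ->; apply: degree_leZ.
move=> [c [z1 [z2 [h1 h2 ->]]]]; rewrite !mulrDl -!mulrA addSn.
apply: degree_leD; last exact/degree_leMt/IH.
apply: degree_leD; last exact/degree_leMs/IH.
by apply: degree_leZ; apply: degree_le_mono hw; rewrite -addSn leq_addl.
Qed.

Lemma degree_leX s t d n z : degree_le s t d z -> degree_le s t (n * d) (z ^+ n).
Proof.
move=> h; elim: n => [|n IH]; first by exists 1; rewrite rmorph1.
by rewrite exprS mulSn; apply: degree_leM.
Qed.

Lemma degree_le_coords s t : degree_le s t 1 s /\ degree_le s t 1 t.
Proof.
split; [rewrite -[X in degree_le _ _ _ X]mulr1; apply: degree_leMs|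
        rewrite -[X in degree_le _ _ _ X]mulr1; apply: degree_leMt];
by exists 1; rewrite rmorph1.
Qed.

Lemma degree_le_change s t s' t' d z :
    degree_le s t 1 s' -> degree_le s t 1 t' ->
  degree_le s' t' d z -> degree_le s t d z.
Proof.
move=> hs ht; elim: d z => [//|d IH] z [c [z1 [z2 [/IH h1 /IH h2 ->]]]].
apply: degree_leD; last by rewrite -add1n; apply: degree_leM.
apply: degree_leD; last by rewrite -add1n; apply: degree_leM.
exact: degree_leC.
Qed.

End DegreeLe.

(** * Spaces of functions with bounded poles at infinity *)

Section DegreeRegular.
Variables (m : nat) (K : closedFieldType) (L : fieldType).
Variables (j : {rmorphism K -> L}) (x y : L).
Hypothesis mK : m%:R != 0 :> K.
Hypothesis ff : fermat_function_field m j x y.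

(** The functions on the curve with poles only at infinity, of order at most d,
    are the polynomials of degree at most d: projective normality of the curve. *)
Lemma regular_degree_le z d : affine_regular j x y z ->
  infinity_regular j x y d z -> degree_le j x y d z.
Proof.
move=> /(regular_poly mK ff) [g0 ->].
have [g <- sg] := ev2_normal_form mK ff g0 => /(degree_bound mK ff sg) Hd.
rewrite ev2E; apply: big_ind; first by rewrite -(rmorph0 j); apply: degree_leC.
  exact: degree_leD.
move=> l _; rewrite ev1E mulr_suml; apply: big_ind.
- by rewrite -(rmorph0 j); apply: degree_leC.
- exact: degree_leD.
move=> r _; rewrite -mulrA.
have [h|h] := leqP (l + r) d; last first.
  by rewrite (Hd _ _ h) rmorph0 mul0r -(rmorph0 j); apply: degree_leC.
apply/degree_leZ/(degree_le_mono h); rewrite addnC.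
have [hx hy] := degree_le_coords j x y.
by apply: degree_leM; rewrite -[X in degree_le _ _ _ X _]muln1; apply: degree_leX.
Qed.

Lemma degree_le_ring (P : place j) u v d z :
  place_ring P u -> place_ring P v -> degree_le j u v d z -> place_ring P z.
Proof.
move=> Ou Ov; elim: d z => [|d IH] z /=; first by case=> c ->; apply: place_ringC.
move=> [c [z1 [z2 [/IH h1 /IH h2 ->]]]].
by apply: place_ringD; [apply: place_ringD;
  [apply: place_ringC|apply: place_ringM]|apply: place_ringM].
Qed.

Lemma degree_le_infinity d z : degree_le j x y d z -> infinity_regular j x y d z.
Proof.
have x0 := transcendental_neq0 ff.
move=> + P w Pw; have [Ox' Oy'] := centered_ring Pw.
elim: d z => [|d IH] z /=; first by case=> c ->; rewrite divr1; apply: place_ringC.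
move=> [c [z1 [z2 [/IH h1 /IH h2 ->]]]].
have -> : (j c + x * z1 + y * z2) / x ^+ d.+1 =
    j c * x^-1 ^+ d.+1 + z1 / x ^+ d + y / x * (z2 / x ^+ d).
  by rewrite exprVn exprS; field; rewrite x0 expf_neq0.
by apply: place_ringD; [apply: place_ringD => //;
  apply: place_ringM (place_ringC _ _) (place_ringX _ _)|apply: place_ringM].
Qed.

End DegreeRegular.

(** * Residues *)

Section Residues.
Variables (K L : fieldType) (j : {rmorphism K -> L}) (P : place j).
Implicit Types (u v : L) (a b : K).

Definition residue_at u a := place_ideal P (u - j a).

Lemma residueC a : residue_at (j a) a.
Proof. by rewrite /residue_at subrr; apply: place_ideal0. Qed.

Lemma residue_ring u a : residue_at u a -> place_ring P u.
Proof. by move=> h; rewrite -(subrK (j a) u);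
  apply: place_ringD (place_ringC _ _); apply: place_ideal_ring. Qed.

Lemma residueD u v a b : residue_at u a -> residue_at v b ->
  residue_at (u + v) (a + b).
Proof. by move=> h k; rewrite /residue_at rmorphD opprD addrACA;
  apply: place_idealD. Qed.

Lemma residueN u a : residue_at u a -> residue_at (- u) (- a).
Proof. by move=> h; rewrite /residue_at rmorphN -opprD; apply: place_idealN. Qed.

Lemma residueB u v a b : residue_at u a -> residue_at v b ->
  residue_at (u - v) (a - b).
Proof. by move=> h k; apply/residueD/residueN. Qed.

Lemma residueM u v a b : residue_at u a -> residue_at v b ->
  residue_at (u * v) (a * b).
Proof.
move=> h k; rewrite /residue_at rmorphM.
have -> : u * v - j a * j b = (u - j a) * v + j a * (v - j b) by ring.
by apply: place_idealD;
  [apply: place_idealMr (residue_ring k)|apply: place_idealMl (place_ringC _ _) _].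
Qed.

Lemma residueX u a n : residue_at u a -> residue_at (u ^+ n) (a ^+ n).
Proof.
move=> h; elim: n => [|n IH]; last by rewrite !exprS; apply: residueM.
by rewrite !expr0 -(rmorph1 j); apply: residueC.
Qed.

Lemma residue_ideal u : residue_at u 0 <-> place_ideal P u.
Proof. by rewrite /residue_at rmorph0 subr0. Qed.

Lemma residue_ideal_eq0 u a : residue_at u a -> place_ideal P u -> a = 0.
Proof. by move=> h /residue_ideal k; apply: place_ideal_const_eq h k. Qed.

Lemma residue_unit u a : residue_at u a -> a != 0 -> ring_units (place_ring P) u.
Proof.
move=> h a0; apply/ring_unitsNM; split; first exact: residue_ring h.
by move/(residue_ideal_eq0 h)/eqP; rewrite (negPf a0).
Qed.

End Residues.

(** * The conic with high contact: algebraic identities *)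

Section ConicAlgebra.
Variable R : fieldType.
Implicit Types A B U V X Y a b x y d e : R.

(** For x = u^2, y = v^2, A = s^2 and B = r^2 this is the product of the four
    lines 1 +- s u +- r v. *)
Definition conic A B x y := (A * x - B * y) ^+ 2 - 2 * (A * x + B * y) + 1.

(** The tangent of the Fermat curve at (a, b), when U = a^m and V = b^m. *)
Definition tangent U V a b x y := U / a * x + V / b * y + 1.

(** The polar, with respect to the conic, of the point where the tangent meets
    the line at infinity: the conic touches both of these lines. *)
Definition polar A B U V x y := A * x - B * y + (U - V).

Lemma conic_tangent A B U V a b x y : a != 0 -> b != 0 -> U + V = -1 ->
  A * a = U ^+ 2 -> B * b = V ^+ 2 ->
  conic A B x y = polar A B U V x y ^+ 2 + 4 * (U * V) * tangent U V a b x y.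
Proof.
move=> a0 b0 UV Aa Bb.
have -> : A = U ^+ 2 / a by rewrite -Aa mulfK.
have -> : B = V ^+ 2 / b by rewrite -Bb mulfK.
have -> : V = -1 - U by rewrite -UV addrC addKr.
by rewrite /conic /polar /tangent; field; rewrite a0 b0.
Qed.

(** The conic with A = x' and B = y' vanishes identically in this situation, and
    the right hand side is the rest of its Taylor expansion at (x', y') in the
    variables A and B.  On the curve it is applied with x' = x^q, y' = y^q and
    d = x^q - a^q = (x - a)^q, e = (y - b)^q. *)
Lemma conic_frobenius X Y x y x' y' d e : X + Y = -1 ->
  x' * x = X ^+ 2 -> y' * y = Y ^+ 2 ->
  conic (x' - d) (y' - e) x y =
    (x * d - y * e) ^+ 2 - 4 * (x * Y * d + y * X * e).
Proof.
move=> XY xx yy; rewrite /conic !mulrBl xx yy.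
have -> : Y = -1 - X by rewrite -XY addrC addKr.
ring.
Qed.

Lemma conic_expand A B U V a b x y : U + V = -1 ->
  A * a = U ^+ 2 -> B * b = V ^+ 2 ->
  conic A B x y = 4 * (A * V * (x - a) + B * U * (y - b))
    + (A * (x - a) - B * (y - b)) ^+ 2.
Proof.
move=> UV Aa Bb.
have -> : A * (x - a) = A * x - U ^+ 2 by rewrite -Aa; ring.
have -> : B * (y - b) = B * y - V ^+ 2 by rewrite -Bb; ring.
have -> : A * V * (x - a) = V * (A * x - U ^+ 2) by rewrite -Aa; ring.
have -> : B * U * (y - b) = U * (B * y - V ^+ 2) by rewrite -Bb; ring.
have -> : V = -1 - U by rewrite -UV addrC addKr.
rewrite /conic; ring.
Qed.

Lemma x_coord A B U V a b x y : a != 0 -> b != 0 -> U != 0 -> V != 0 ->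
  U + V = -1 -> A * a = U ^+ 2 -> B * b = V ^+ 2 ->
  x - a = - (a / U) * (polar A B U V x y + V * tangent U V a b x y).
Proof.
move=> a0 b0 U0 V0 UV Aa Bb.
have -> : A = U ^+ 2 / a by rewrite -Aa mulfK.
have -> : B = V ^+ 2 / b by rewrite -Bb mulfK.
have E : V = -1 - U by rewrite -UV addrC addKr.
by rewrite /polar /tangent E; field; rewrite a0 b0.
Qed.

Lemma y_coord A B U V a b x y : a != 0 -> b != 0 -> U != 0 -> V != 0 ->
  U + V = -1 -> A * a = U ^+ 2 -> B * b = V ^+ 2 ->
  y - b = b / V * (polar A B U V x y - U * tangent U V a b x y).
Proof.
move=> a0 b0 U0 V0 UV Aa Bb.
have -> : A = U ^+ 2 / a by rewrite -Aa mulfK.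
have -> : B = V ^+ 2 / b by rewrite -Bb mulfK.
have E : U = -1 - V by rewrite -UV addrK.
by rewrite /polar /tangent E; field; rewrite a0 b0.
Qed.

End ConicAlgebra.

Section FrobeniusCurve.
Variables (R : fieldType) (m q : nat).
Hypotheses (q1_eq : q.+1 = (2 * m)%N) (q_eq0 : q%:R = 0 :> R).
Hypothesis frob : forall u v : R, (u + v) ^+ q = u ^+ q + v ^+ q.

Lemma two_m_eq1 : 2%:R * m%:R = 1 :> R.
Proof. by rewrite -natrM -q1_eq -natr1 q_eq0 add0r. Qed.

Lemma two_neq0 : 2%:R != 0 :> R.
Proof.
by apply: contra_eq_neq two_m_eq1 => ->; rewrite mul0r eq_sym oner_eq0.
Qed.

Lemma m_neq0 : m%:R != 0 :> R.
Proof.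
by apply: contra_eq_neq two_m_eq1 => ->; rewrite mulr0 eq_sym oner_eq0.
Qed.

Lemma frobN u : (- u) ^+ q = - u ^+ q :> R.
Proof.
apply/eqP; rewrite -addr_eq0 -frob addNr expr0n.
by case: q q1_eq => //; lia.
Qed.

Lemma frobB u v : (u - v) ^+ q = u ^+ q - v ^+ q :> R.
Proof. by rewrite frob frobN. Qed.

Lemma frob_inj u v : u ^+ q = v ^+ q -> u = v :> R.
Proof.
move=> h; apply/eqP; rewrite -subr_eq0.
have : (u - v) ^+ q == 0 by rewrite frobB h subrr.
by rewrite expf_eq0 => /andP[].
Qed.

Lemma mul_frob (c : R) : c ^+ q * c = (c ^+ m) ^+ 2.
Proof. by rewrite -exprSr q1_eq mulnC exprM. Qed.

Variables (a b : R).
Hypotheses (ab : a ^+ m + b ^+ m + 1 = 0) (a0 : a != 0) (b0 : b != 0).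
Local Notation A := (a ^+ q).
Local Notation B := (b ^+ q).
Local Notation U := (a ^+ m).
Local Notation V := (b ^+ m).

Lemma curve_sum : U + V = -1.
Proof. by apply/eqP; rewrite -addr_eq0 ab. Qed.

Lemma curve_frob (c d : R) : c ^+ m + d ^+ m + 1 = 0 ->
  (c ^+ q) ^+ m + (d ^+ q) ^+ m + 1 = 0.
Proof.
move=> cd; rewrite -!exprM ![(q * m)%N]mulnC !exprM -frob.
have -> : c ^+ m + d ^+ m = -1 by apply/eqP; rewrite -addr_eq0 cd.
by rewrite frobN expr1n addNr.
Qed.

(** The contact of the conic with the curve has order exactly q, and not more,
    under this condition.  It holds at the points that are not fixed by the
    q^2-Frobenius ([nonrationalP]). *)
Definition nonrational := V * U ^+ q != U * V ^+ q.

Lemma nonrational_frob : nonrational ->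
  V ^+ q * U ^+ (q * q) != U ^+ q * V ^+ (q * q).
Proof.
by rewrite /nonrational; apply: contra_neq => h; apply: frob_inj;
   rewrite !exprMn -![(_ ^+ q) ^+ q]exprM.
Qed.

(** If V/U is fixed by the q-Frobenius then so are U and V, because
    U + V = -1; then a^(q+1) = U^2 is fixed as well, whence a^(q^2) = a. *)
Lemma nonrationalP : nonrational \/ (a ^+ (q ^ 2) = a /\ b ^+ (q ^ 2) = b).
Proof.
have [h|] := boolP (V * U ^+ q != U * V ^+ q); [by left|].
rewrite negbK => /eqP h; right.
have VE : V = -1 - U by rewrite -curve_sum addrC addKr.
have UU : U ^+ q = U.
  move: h; rewrite VE frobB frobN expr1n => h.
  have -> : U ^+ q = - ((-1 - U) * U ^+ q) - U * U ^+ q by ring.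
  by rewrite h; ring.
have VV : V ^+ q = V by rewrite VE frobB frobN expr1n UU.
have H (c : R) : c != 0 -> (c ^+ m) ^+ q = c ^+ m -> c ^+ (q ^ 2) = c.
  move=> c0 cq; have cq0 : c ^+ q != 0 by rewrite expf_neq0.
  apply: (mulIf cq0).
  by rewrite -mulnn exprM -exprMn mul_frob [LHS]exprAC cq mulrC mul_frob.
by split; apply: H.
Qed.

End FrobeniusCurve.

Section ConicZeros.
Variables (R : closedFieldType) (m q : nat).
Hypotheses (q1_eq : q.+1 = (2 * m)%N) (q_eq0 : q%:R = 0 :> R).
Hypothesis frob : forall u v : R, (u + v) ^+ q = u ^+ q + v ^+ q.
Variables (a b : R).
Hypotheses (ab : a ^+ m + b ^+ m + 1 = 0) (a0 : a != 0) (b0 : b != 0).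
Local Notation A := (a ^+ q).
Local Notation B := (b ^+ q).

(** On the Hermitian curve u^(q+1) + v^(q+1) + 1 = 0 above the Fermat curve, the
    line 1 + s^q u + r^q v = 0 is the tangent at (s, r), and eliminating v gives
    (u^q - s^q) (u - s^(q^2)) = 0. *)
Lemma conic_zeros (c d : R) : c ^+ m + d ^+ m + 1 = 0 -> conic A B c d = 0 ->
  (c = a /\ d = b) \/ (c = a ^+ (q ^ 2) /\ d = b ^+ (q ^ 2)).
Proof.
move=> cd C0.
have [s Es] := ex_mth_root (two_neq0 q1_eq q_eq0) a; have [r Er] :=
  ex_mth_root (two_neq0 q1_eq q_eq0) b.
have [u0 Eu0] := ex_mth_root (two_neq0 q1_eq q_eq0) c; have [v0 Ev0] :=
  ex_mth_root (two_neq0 q1_eq q_eq0) d.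
(* the conic is the product of the four conjugate lines; one of them vanishes *)
have [u [v [Eu Ev L0]]] : exists u v,
    [/\ u ^+ 2 = c, v ^+ 2 = d & 1 + u * s ^+ q + v * r ^+ q = 0].
  have : (1 + u0 * s ^+ q + v0 * r ^+ q) * (1 + u0 * s ^+ q + - v0 * r ^+ q) *
     (1 + - u0 * s ^+ q + v0 * r ^+ q) * (1 + - u0 * s ^+ q + - v0 * r ^+ q) = 0.
    rewrite -[RHS]C0 /conic -Eu0 -Ev0 -Es -Er -!exprM ![(2 * q)%N]mulnC !exprM.
    ring.
  move/eqP; rewrite !mulf_eq0 -!orbA => /or4P[] /eqP h.
  - by exists u0, v0.
  - by exists u0, (- v0); rewrite sqrrN.
  - by exists (- u0), v0; rewrite sqrrN.
  - by exists (- u0), (- v0); rewrite !sqrrN.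
have pw (w : R) : w ^+ q * w = (w ^+ 2) ^+ m by rewrite -exprSr q1_eq exprM.
have H1 : s ^+ q * s + r ^+ q * r = -1 by rewrite !pw Es Er (curve_sum ab).
have H2 : u ^+ q * u + v ^+ q * v = -1.
  by rewrite !pw Eu Ev; apply/eqP; rewrite -addr_eq0 cd.
have H3 : (s ^+ q) ^+ q * s ^+ q + (r ^+ q) ^+ q * r ^+ q = -1.
  by rewrite -!exprMn -frob H1 (frobN q1_eq frob) expr1n.
have sb : r ^+ q != 0.
  by apply: contra_neq b0; rewrite -Er => /eqP;
    rewrite expf_eq0 => /andP[_ /eqP ->]; rewrite expr0n.
have L1 : v * r ^+ q = - (1 + u * s ^+ q) 
  by apply/eqP; rewrite -addr_eq0 addrC L0.
have L2 : v ^+ q * (r ^+ q) ^+ q = - (1 + u ^+ q * (s ^+ q) ^+ q).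
  by rewrite -exprMn L1 (frobN q1_eq frob) frob expr1n exprMn.
have : (u ^+ q - s ^+ q) * (u - (s ^+ q) ^+ q) = 0.
  have e2 : v ^+ q * v = -1 - u ^+ q * u by rewrite -H2; ring.
  have e3 : (r ^+ q) ^+ q * r ^+ q = -1 - (s ^+ q) ^+ q * s ^+ q by rewrite -H3;
    ring.
  have : (v ^+ q * v) * ((r ^+ q) ^+ q * r ^+ q) =
         (v ^+ q * (r ^+ q) ^+ q) * (v * r ^+ q) by ring.
  rewrite e2 e3 L1 L2 => /eqP; rewrite -subr_eq0 => /eqP h.
  by rewrite -[RHS]h; ring.
move/eqP; rewrite mulf_eq0 !subr_eq0 => /orP[] /eqP us; [left|right].
  have us' := frob_inj q1_eq frob us.
  split; first by rewrite -Eu us' Es.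
  rewrite -Ev -Er; congr (_ ^+ 2); apply: (mulIf sb).
  by rewrite L1 us' -[RHS](addKr (s ^+ q * s)) [r * _]mulrC H1; ring.
have vr : v = (r ^+ q) ^+ q.
  apply: (mulIf sb).
  by rewrite L1 us -[RHS](addKr ((s ^+ q) ^+ q * s ^+ q)) H3; ring.
split; [rewrite -Eu us -Es|rewrite -Ev vr -Er];
  by rewrite -mulnn -!exprM; congr (_ ^+ _); lia.
Qed.

End ConicZeros.

(** * The conic at its contact point *)

Section ConicOnCurve.
Variables (m q : nat) (K : closedFieldType) (L : fieldType).
Variables (j : {rmorphism K -> L}) (x y : L).
Hypotheses (q1_eq : q.+1 = (2 * m)%N) (q_eq0 : q%:R = 0 :> K) (q_ge3 : (3 <= q)%N).
Hypothesis frobK : forall u v : K, (u + v) ^+ q = u ^+ q + v ^+ q.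
Hypothesis frobL : forall u v : L, (u + v) ^+ q = u ^+ q + v ^+ q.
Hypothesis ff : fermat_function_field m j x y.
Let mK : m%:R != 0 :> K := m_neq0 q1_eq q_eq0.

Definition conic_at (a b : K) : L := conic (j (a ^+ q)) (j (b ^+ q)) x y.
Definition tangent_at (a b : K) : L :=
  tangent (j (a ^+ m)) (j (b ^+ m)) (j a) (j b) x y.
Definition polar_at (a b : K) : L :=
  polar (j (a ^+ q)) (j (b ^+ q)) (j (a ^+ m)) (j (b ^+ m)) x y.

Lemma four_neq0 : j 4%:R != 0.
Proof.
rewrite fmorph_eq0 (_ : 4 = 2 * 2)%N // natrM mulf_neq0 //;
  exact: two_neq0 q1_eq q_eq0.
Qed.

Lemma conic_residue (P : place j) a b c d : centered P x y c d ->
  residue_at P (conic_at a b) (conic (a ^+ q) (b ^+ q) c d).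
Proof.
move=> [hx hy]; rewrite /conic_at /conic -(rmorph_nat j 2) -(rmorph1 j).
apply: residueD (residueC _ _); apply: residueB.
  by apply: residueX; apply: residueB; apply: residueM => //; apply: residueC.
apply: residueM; first exact: residueC.
by apply: residueD; apply: residueM => //; apply: residueC.
Qed.

Lemma tangent_residue (P : place j) a b c d : centered P x y c d ->
  residue_at P (tangent_at a b) (tangent (a ^+ m) (b ^+ m) a b c d).
Proof.
move=> [hx hy]; rewrite /tangent_at /tangent -(rmorph1 j) -!fmorph_div.
apply: residueD (residueC _ _); apply: residueD;
by apply: residueM => //; apply: residueC.
Qed.

Lemma polar_residue (P : place j) a b c d : centered P x y c d ->
  residue_at P (polar_at a b) (polar (a ^+ q) (b ^+ q) (a ^+ m) (b ^+ m) c d).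
Proof.
move=> [hx hy]; rewrite /polar_at /polar -rmorphB.
apply: residueD (residueC _ _); apply: residueB;
by apply: residueM => //; apply: residueC.
Qed.

Lemma tangent_degree a b : degree_le j x y 1 (tangent_at a b).
Proof.
exists 1, (j (a ^+ m / a)), (j (b ^+ m / b)); split; try by eexists.
by rewrite /tangent_at /tangent !fmorph_div rmorph1; ring.
Qed.

Lemma polar_degree a b : degree_le j x y 1 (polar_at a b).
Proof.
exists (a ^+ m - b ^+ m), (j (a ^+ q)), (j (- b ^+ q)); split; try by eexists.
by rewrite /polar_at /polar !rmorphB rmorphN; ring.
Qed.

Section AtPoint.
Variables (a b : K).
Hypotheses (ab : a ^+ m + b ^+ m + 1 = 0) (a0 : a != 0) (b0 : b != 0).
Local Notation U := (a ^+ m).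
Local Notation V := (b ^+ m).
Local Notation C := (conic_at a b).
Local Notation T := (tangent_at a b).
Local Notation E := (polar_at a b).

Lemma jA_a : j (a ^+ q) * j a = j U ^+ 2.
Proof. by rewrite -[RHS]rmorphXn -(mul_frob q1_eq) rmorphM. Qed.

Lemma jB_b : j (b ^+ q) * j b = j V ^+ 2.
Proof. by rewrite -[RHS]rmorphXn -(mul_frob q1_eq) rmorphM. Qed.

Lemma jUV : j U + j V = -1.
Proof. by rewrite -rmorphD (curve_sum ab) rmorphN rmorph1. Qed.

Lemma ja0 : j a != 0. Proof. by rewrite fmorph_eq0. Qed.

Lemma jb0 : j b != 0. Proof. by rewrite fmorph_eq0. Qed.

Lemma jU0 : j U != 0. Proof. by rewrite fmorph_eq0 expf_neq0. Qed.

Lemma jV0 : j V != 0. Proof. by rewrite fmorph_eq0 expf_neq0. Qed.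

Lemma conic_atE : C = E ^+ 2 + j (4%:R * (U * V)) * T.
Proof.
rewrite rmorphM rmorph_nat rmorphM.
exact: conic_tangent ja0 jb0 jUV jA_a jB_b.
Qed.

Lemma conic_degree : degree_le j E T 2 C.
Proof.
rewrite conic_atE; have [hE hT] := degree_le_coords j E T.
apply: degree_leD; first exact: (degree_leX 2 hE).
exact/degree_leZ/(degree_le_mono _ hT).
Qed.

Lemma x_atE : x - j a = j (- (a / U)) * (E + j V * T).
Proof.
rewrite rmorphN fmorph_div.
exact: x_coord ja0 jb0 jU0 jV0 jUV jA_a jB_b.
Qed.

Lemma y_atE : y - j b = j (b / V) * (E - j U * T).
Proof.
rewrite fmorph_div.
exact: y_coord ja0 jb0 jU0 jV0 jUV jA_a jB_b.
Qed.

Lemma x_degree : degree_le j E T 1 x.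
Proof.
have [hE hT] := degree_le_coords j E T.
rewrite -(subrK (j a) x) x_atE; apply: degree_leD (degree_leC _ _ _ _ _).
by apply/degree_leZ/degree_leD => //; apply: degree_leZ.
Qed.

Lemma y_degree : degree_le j E T 1 y.
Proof.
have [hE hT] := degree_le_coords j E T.
rewrite -(subrK (j b) y) y_atE; apply: degree_leD (degree_leC _ _ _ _ _).
apply/degree_leZ/degree_leD => //.
by rewrite -mulNr -rmorphN; apply: degree_leZ.
Qed.

Lemma degree_le_polar_tangent d z : degree_le j x y d z <-> degree_le j E T d z.
Proof.
split; apply: degree_le_change; [exact: x_degree|exact: y_degree| |].
  exact: polar_degree.
exact: tangent_degree.
Qed.

Variable P : place j.
Hypothesis Pab : centered P x y a b.
Local Notation v := (place_val P).
Let dP : discrete P := place_discrete mK ff P.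

(** This exhibits the contact of order q: every term is divisible by
    (x - a)^q or (y - b)^q. *)
Lemma conic_frobeniusE :
  C = (x * (x - j a) ^+ q - y * (y - j b) ^+ q) ^+ 2
    - 4 * (x * y ^+ m * (x - j a) ^+ q + y * x ^+ m * (y - j b) ^+ q).
Proof.
have fB (u w : L) : (u - w) ^+ q = u ^+ q - w ^+ q.
  by rewrite frobL (frobN q1_eq frobL).
have XY : x ^+ m + y ^+ m = -1 by apply/eqP; rewrite -addr_eq0 (fermat_eq ff).
rewrite -(conic_frobenius _ _ XY (mul_frob q1_eq x) (mul_frob q1_eq y)).
by rewrite /conic_at !fB !subKr !rmorphXn.
Qed.

Lemma x_ideal : place_ideal P (x - j a). Proof. by case: Pab. Qed.

Lemma y_ideal : place_ideal P (y - j b). Proof. by case: Pab. Qed.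

Lemma xy_ring : place_ring P x /\ place_ring P y.
Proof. exact: centered_ring Pab. Qed.

Lemma conic_ord : ord_ge P q%:Z C.
Proof.
have [Ox Oy] := xy_ring.
have hx := ord_geX_ideal dP q x_ideal; have hy := ord_geX_ideal dP q y_ideal.
rewrite conic_frobeniusE; apply: ord_geB => //.
  rewrite expr2; apply: ord_geMr => //; last first.
    by apply: ord_geB => //; apply: ord_geMr.
  by apply: place_ringB; apply: place_ringM => //; apply: place_ringX;
    apply: place_ideal_ring; [apply: x_ideal|apply: y_ideal].
apply: ord_geMr => //; first by rewrite -(rmorph_nat j); apply: place_ringC.
by apply: ord_geD => //; apply: ord_geMr => //; apply: place_ringM => //;
  apply: place_ringX.
Qed.

Lemma polar_ideal : place_ideal P E.
Proof.
have := polar_residue a b Pab; rewrite /polar !(mul_frob q1_eq) subr_sqr.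
by rewrite (curve_sum ab) mulrN1 addNr => /residue_ideal.
Qed.

(** 4 U V T = C - E^2, and both terms on the right have order at least 2. *)
Lemma tangent_ord : ord_ge P 2 T.
Proof.
have k0 : j (4%:R * (U * V)) != 0.
  by rewrite rmorphM mulf_neq0 ?four_neq0 // rmorphM mulf_neq0 ?jU0 ?jV0.
have -> : T = j (4%:R * (U * V))^-1 * (C - E ^+ 2).
  by rewrite conic_atE fmorphV addrC addKr mulKf.
apply: ord_geMr => //; first exact: place_ringC.
apply: ord_geB => //; last exact: (ord_geX_ideal dP 2 polar_ideal).
by apply: ord_ge_le conic_ord; rewrite lez_nat ltnW.
Qed.

(** x - a is a combination of E and T, and T has order at least 2. *)
Lemma polar_val : E != 0 /\ v E = 1.
Proof.
have [ux _] := discrete_unramified mK ff Pab b0.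
have k0 : - (U / a) != 0 by rewrite oppr_eq0 mulf_neq0 ?invr_eq0 ?expf_neq0.
have -> : E = j (- (U / a)) * (x - j a) + - (j V * T).
  rewrite x_atE rmorphN rmorphN !fmorph_div mulrA mulrNN.
  have -> : j U / j a * (j a / j U) = 1 by field; rewrite jU0 ja0.
  by rewrite mul1r addrK.
have z0 : j (- (U / a)) * (x - j a) != 0.
  by rewrite mulf_neq0 ?fmorph_eq0 // (XsubC_neq0 ff).
have vz : v (j (- (U / a)) * (x - j a)) = 1.
  rewrite place_valM ?fmorph_eq0 ?(XsubC_neq0 ff) // place_valC // add0r.
  exact: uniformizer_val.
have [|n0 ->] := place_val_add dP (w := - (j V * T)) z0; last by [].
by rewrite vz; apply/ord_geN/ord_geMr => //;
  [apply: place_ringC|apply: tangent_ord].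
Qed.

(** 4 U V T = C - E^2, where the conic has order at least 3 and E^2 order 2. *)
Lemma tangent_val : T != 0 /\ v T = 2.
Proof.
have [E0 vE] := polar_val.
have k0 : (4%:R * (U * V))^-1 != 0 :> K.
  by rewrite invr_eq0 -(fmorph_eq0 j) rmorphM mulf_neq0 ?four_neq0 // rmorphM mulf_neq0 ?jU0 ?jV0.
have -> : T = j (- (4%:R * (U * V))^-1) * (E ^+ 2 + - C).
  rewrite {1}conic_atE opprD addrA subrr add0r rmorphN mulrNN fmorphV mulKf //.
  by rewrite -invr_eq0 -fmorphV fmorph_eq0.
have vE2 : v (E ^+ 2) = 2 by rewrite place_valX // vE.
have [|n0 vn] := place_val_add dP (w := - C) (expf_neq0 2 E0).
  rewrite vE2; apply: ord_geN => //; apply: ord_ge_le conic_ord.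
  by rewrite lez_nat.
by rewrite mulf_neq0 ?fmorph_eq0 ?oppr_eq0 // place_valM ?fmorph_eq0 ?oppr_eq0 //
           place_valC ?oppr_eq0 // add0r vn.
Qed.

(** Expressed through E and T by [x_atE] and [y_atE], the identity
    [conic_frobeniusE] reads C = E^q k up to terms of order 2q, and the value of
    k at P is nonzero by [nonrational]. *)
Lemma conic_val : nonrational m q a b -> C != 0 /\ v C = q%:Z.
Proof.
move=> nr; have [Ox Oy] := xy_ring.
have fN (u : L) : (- u) ^+ q = - u ^+ q by apply: (frobN q1_eq frobL).
have fB (u w : L) : (u - w) ^+ q = u ^+ q - w ^+ q by rewrite frobL fN.
pose k := - (4%:R * (j (- (a / U) ^+ q) * (x * y ^+ m) + j ((b / V) ^+ q) * (y * x ^+ m))).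
pose r := j (- (a / U) ^+ q) * (x * y ^+ m) * j V ^+ q
          - j ((b / V) ^+ q) * (y * x ^+ m) * j U ^+ q.
pose s := x * (x - j a) ^+ q - y * (y - j b) ^+ q.
have EC : C = E ^+ q * k + (s ^+ 2 - 4%:R * (T ^+ q * r)).
  rewrite conic_frobeniusE -/s x_atE y_atE !exprMn fB frobL !exprMn.
  rewrite -[j (- (a / U)) ^+ q]rmorphXn -[j (b / V) ^+ q]rmorphXn.
  rewrite (frobN q1_eq frobK) /k /r; ring.
have Or : place_ring P r.
  by rewrite /r -!rmorphXn; apply: place_ringB;
    apply: place_ringM (place_ringC _ _);
     apply: place_ringM (place_ringC _ _) _; apply: place_ringM => //;
       apply: place_ringX.
have [E0 vE] := polar_val.
have vEq : v (E ^+ q) = q%:Z by rewrite place_valX // vE -mulr_natr mul1r natz.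
have k_unit : ring_units (place_ring P) k.
  case: (Pab) => hx hy.
  have : residue_at P k
     (- (4%:R * (- (a / U) ^+ q * (a * V) + (b / V) ^+ q * (b * U)))).
    rewrite /k; apply: residueN; apply: residueM.
      by rewrite -(rmorph_nat j); apply: residueC.
    by apply: residueD; apply: residueM; rewrite ?residueC //;
       try (by apply: residueC); apply: residueM => //; apply: residueX.
  move/residue_unit; apply; rewrite oppr_eq0 mulf_neq0 //.
    by rewrite -(fmorph_eq0 j) four_neq0.
  have Un0 : U != 0 by rewrite expf_neq0.
  have Vn0 : V != 0 by rewrite expf_neq0.
  have -> : - (a / U) ^+ q * (a * V) + (b / V) ^+ q * (b * U) =
      (V * U ^+ q - U * V ^+ q) * (U * V / (U ^+ q * V ^+ q)).
    rewrite !expr_div_n.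
    have -> : - (a ^+ q / U ^+ q) * (a * V) = - (a ^+ q * a) / U ^+ q * V by ring.
    have -> : b ^+ q / V ^+ q * (b * U) = (b ^+ q * b) / V ^+ q * U by ring.
    by rewrite !(mul_frob q1_eq); field; rewrite ?expf_neq0.
  by rewrite mulf_neq0 ?subr_eq0 // !mulf_neq0 ?invr_eq0 ?mulf_neq0 ?expf_neq0.
have /ring_unitsNM [Ok nMk] := k_unit.
have k0 : k != 0 by case/ring_unitsE: k_unit.
have vk : v k = 0 by apply/place_val_unit.
have z0 : E ^+ q * k != 0 by rewrite mulf_neq0 ?expf_neq0.
have vz : v (E ^+ q * k) = q%:Z.
  by rewrite place_valM ?expf_neq0 // vEq vk addr0.
have [|n0 vn] := place_val_add dP (w := s ^+ 2 - 4%:R * (T ^+ q * r)) z0;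
  last first.
  by rewrite EC vn vz.
rewrite vz; have q2 : q%:Z + 1 <= 2 *+ q by rewrite -mulr_natr natz; lia.
have hs : ord_ge P q%:Z s.
  by apply: ord_geB => //; apply: ord_geMr => //; apply: ord_geX_ideal => //;
     [apply: x_ideal|apply: y_ideal].
apply: ord_geB => //.
  by have := ord_geX dP 2 hs; apply: ord_ge_le; rewrite mulr2n; lia.
apply: ord_geMr => //; first by rewrite -(rmorph_nat j); apply: place_ringC.
rewrite mulrC; apply: ord_geMr => //.
by apply: ord_ge_le q2 _; apply: (ord_geX dP q tangent_ord).
Qed.

End AtPoint.
End ConicOnCurve.

(** * The divisor of the conic *)

Section ConicDivisor.
Variables (m q : nat) (K : closedFieldType) (L : fieldType).
Variables (j : {rmorphism K -> L}) (x y : L).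
Hypotheses (q1_eq : q.+1 = (2 * m)%N) (q_eq0 : q%:R = 0 :> K) (q_ge3 : (3 <= q)%N).
Hypothesis frobK : forall u v : K, (u + v) ^+ q = u ^+ q + v ^+ q.
Hypothesis frobL : forall u v : L, (u + v) ^+ q = u ^+ q + v ^+ q.
Hypothesis ff : fermat_function_field m j x y.
Let mK : m%:R != 0 :> K := m_neq0 q1_eq q_eq0.
Variables (a b : K).
Hypotheses (ab : a ^+ m + b ^+ m + 1 = 0) (a0 : a != 0) (b0 : b != 0).
Hypothesis not_fixed : ~ (a ^+ (q ^ 2) = a /\ b ^+ (q ^ 2) = b).
Local Notation a' := (a ^+ (q ^ 2)).
Local Notation b' := (b ^+ (q ^ 2)).
Local Notation C := (conic_at q j x y a b).

Lemma frob2E (c : K) : c ^+ (q ^ 2) = (c ^+ q) ^+ q.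
Proof. by rewrite -mulnn exprM. Qed.

Lemma curve_frob2 : a' ^+ m + b' ^+ m + 1 = 0.
Proof. by rewrite !frob2E; do 2!apply: (curve_frob q1_eq frobK). Qed.

Lemma frob2_mul (c : K) : c ^+ q * c ^+ (q ^ 2) = ((c ^+ m) ^+ q) ^+ 2.
Proof. by rewrite frob2E mulrC (mul_frob q1_eq); congr (_ ^+ 2); apply: exprAC. Qed.

Lemma curve_sum_frob : (a ^+ m) ^+ q + (b ^+ m) ^+ q = -1.
Proof. by rewrite -frobK (curve_sum ab) (frobN q1_eq frobK) expr1n. Qed.

Lemma conic_other_zero : conic (a ^+ q) (b ^+ q) a' b' = 0.
Proof.
rewrite (conic_expand _ _ curve_sum_frob (frob2_mul a) (frob2_mul b)).
by rewrite !subrr !mulr0 subrr addr0 mulr0 expr0n addr0.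
Qed.

Lemma not_fixed_nonrational : nonrational m q a b.
Proof. by case: (nonrationalP q1_eq frobK ab a0 b0). Qed.

(** Where the conic and the tangent both vanish, so does the polar, and the two
    lines meet only at (a, b). *)
Lemma tangent_other_neq0 : tangent (a ^+ m) (b ^+ m) a b a' b' != 0.
Proof.
have UV := curve_sum ab.
apply: contra_notN not_fixed => /eqP T0.
have := conic_other_zero.
rewrite (conic_tangent _ _ a0 b0 UV (mul_frob q1_eq a) (mul_frob q1_eq b)) T0.
rewrite mulr0 addr0 => /eqP; rewrite expf_eq0 /= => /eqP E0.
have U0 := expf_neq0 m a0; have V0 := expf_neq0 m b0.
have := x_coord a' b' a0 b0 U0 V0 UV (mul_frob q1_eq a) (mul_frob q1_eq b).
have := y_coord a' b' a0 b0 U0 V0 UV (mul_frob q1_eq a) (mul_frob q1_eq b).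
rewrite T0 E0 !mulr0 subr0 addr0 !mulr0 => /eqP; rewrite subr_eq0 => /eqP hb.
by move/eqP; rewrite subr_eq0 => /eqP ha.
Qed.

(** The first order term of the conic at the Frobenius image of the point is not
    a multiple of the tangent there: this is [nonrational] conjugated by
    Frobenius ([nonrational_frob]). *)
Lemma conic_other_val (Q : place j) : centered Q x y a' b' ->
  C != 0 /\ place_val Q C = 1.
Proof.
move=> Qc; have ab' := curve_frob2.
have a0' : a' != 0 by rewrite expf_neq0.
have b0' : b' != 0 by rewrite expf_neq0.
have dQ := place_discrete mK ff Q.
pose T := tangent_at m j x y a' b'; pose E := polar_at m q j x y a' b'.
have [E0 vE] : E != 0 /\ place_val Q E = 1.
  exact: (polar_val q1_eq q_eq0 q_ge3 frobL ff ab' a0' b0' Qc).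
have hT : ord_ge Q 2 T.
  exact: (tangent_ord q1_eq q_eq0 q_ge3 frobL ff ab' a0' b0' Qc).
have Ex : x - j a' = j (- (a' / a' ^+ m)) * (E + j (b' ^+ m) * T).
  exact: (x_atE j x y q1_eq ab' a0' b0').
have Ey : y - j b' = j (b' / b' ^+ m) * (E - j (a' ^+ m) * T).
  exact: (y_atE j x y q1_eq ab' a0' b0').
pose A := a ^+ q; pose B := b ^+ q.
pose U1 := (a ^+ m) ^+ q; pose V1 := (b ^+ m) ^+ q.
pose k := 4%:R * (- (A * V1 * (a' / a' ^+ m)) + B * U1 * (b' / b' ^+ m)).
pose l := 4%:R * (- (A * V1 * (a' / a' ^+ m) * b' ^+ m) - B * U1 * (b' / b' ^+ m) * a' ^+ m).
have k0 : k != 0.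
  have -> : k = 4%:R * (U1 * V1 * (V1 * a' ^+ m - U1 * b' ^+ m) / (a' ^+ m * b' ^+ m)).
    rewrite /k; congr (_ * _).
    have -> : A * V1 * (a' / a' ^+ m) = (A * a') * V1 / a' ^+ m by ring.
    have -> : B * U1 * (b' / b' ^+ m) = (B * b') * U1 / b' ^+ m by ring.
    rewrite /A /B !frob2_mul -/U1 -/V1.
    have := expf_neq0 m a0'; have := expf_neq0 m b0'.
    move: (a' ^+ m) (b' ^+ m) => u v u0 v0; field.
    by rewrite u0 v0.
  have e (c : K) : (c ^+ (q ^ 2)) ^+ m = (c ^+ m) ^+ (q * q).
    by rewrite mulnn exprAC.
  have n0 := nonrational_frob q1_eq frobK not_fixed_nonrational.
  rewrite mulf_neq0 // -?(fmorph_eq0 j) ?four_neq0 //;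
    first exact: four_neq0 q1_eq q_eq0.
  rewrite fmorph_eq0 !mulf_neq0 ?invr_eq0 ?mulf_neq0 ?expf_neq0 //.
  by rewrite !e subr_eq0.
have EC : C = E * j k + (T * j l + (j A * (x - j a') - j B * (y - j b')) ^+ 2).
  have sum : j U1 + j V1 = -1.
    by rewrite -rmorphD curve_sum_frob rmorphN rmorph1.
  have hA : j A * j a' = j U1 ^+ 2 by rewrite -rmorphM frob2_mul rmorphXn.
  have hB : j B * j b' = j V1 ^+ 2 by rewrite -rmorphM frob2_mul rmorphXn.
  rewrite /conic_at (conic_expand _ _ sum hA hB) addrA; congr (_ + _).
  rewrite Ex Ey /k /l !(rmorphM, rmorphD, rmorphN, rmorph_nat); ring.
have vz : place_val Q (E * j k) = 1.
  by rewrite place_valM ?fmorph_eq0 // place_valC // addr0.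
have z0 : E * j k != 0 by rewrite mulf_neq0 ?fmorph_eq0.
have [|n0 vn] := place_val_add dQ
  (w := T * j l + (j A * (x - j a') - j B * (y - j b')) ^+ 2) z0.
  rewrite vz; apply: ord_geD => //.
    by rewrite mulrC; apply: ord_geMr => //; apply: place_ringC.
  apply: (ord_geX_ideal dQ 2); case: Qc => hx hy.
  by apply: place_idealB; apply: place_idealMl => //; apply: place_ringC.
by rewrite EC vn vz.
Qed.

Lemma conic_affine_unit (Q : place j) c d : centered Q x y c d ->
  ~ (c = a /\ d = b) -> ~ (c = a' /\ d = b') -> ring_units (place_ring Q) C.
Proof.
move=> Qc n1 n2; have cd := centered_curve Qc (fermat_eq ff).
apply: residue_unit (conic_residue q a b Qc) _; apply/eqP => h.
by have [] := conic_zeros q1_eq q_eq0 frobK ab a0 b0 cd h.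
Qed.

(** The leading form of the conic is (A X - B Y)^2, and its zero is not on the
    curve because A^m + B^m = -1. *)
Lemma conic_infinite_unit (Q : place j) w : w ^+ m = -1 ->
  centered Q x^-1 (y / x) 0 w -> ring_units (place_ring Q) (C / x ^+ 2).
Proof.
move=> wm [hx hy]; have x0 := transcendental_neq0 ff.
have Eq : C / x ^+ 2 = (j (a ^+ q) - j (b ^+ q) * (y / x)) ^+ 2
    - j 2%:R * (j (a ^+ q) + j (b ^+ q) * (y / x)) * x^-1 + x^-1 ^+ 2.
  by rewrite /conic_at /conic rmorph_nat; field.
have : residue_at Q (C / x ^+ 2) ((a ^+ q - b ^+ q * w) ^+ 2
    - 2%:R * (a ^+ q + b ^+ q * w) * 0 + 0 ^+ 2).
  rewrite Eq; apply: residueD; last exact: residueX.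
  apply: residueB.
    apply: residueX; apply: residueB; first exact: residueC.
    by apply: residueM => //; apply: residueC.
  apply: residueM => //; apply: residueM; first exact: residueC.
  by apply: residueD; [apply: residueC|apply: residueM => //; apply: residueC].
move/residue_unit; apply; rewrite mulr0 subr0 expr0n addr0 expf_eq0 /=.
rewrite subr_eq0; apply/negP => /eqP h.
have := curve_frob q1_eq frobK ab; rewrite h exprMn wm mulrN1 addNr add0r.
by move/eqP; rewrite oner_eq0.
Qed.

End ConicDivisor.

(** * Gaps and non-gaps *)

Section WeierstrassSemigroup.
Variables (m q : nat) (K : closedFieldType) (L : fieldType).
Variables (j : {rmorphism K -> L}) (x y : L).
Hypotheses (q1_eq : q.+1 = (2 * m)%N) (q_eq0 : q%:R = 0 :> K) (q_ge3 : (3 <= q)%N).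
Hypothesis frobK : forall u v : K, (u + v) ^+ q = u ^+ q + v ^+ q.
Hypothesis frobL : forall u v : L, (u + v) ^+ q = u ^+ q + v ^+ q.
Hypothesis ff : fermat_function_field m j x y.
Let mK : m%:R != 0 :> K := m_neq0 q1_eq q_eq0.
Variables (a b : K).
Hypotheses (ab : a ^+ m + b ^+ m + 1 = 0) (a0 : a != 0) (b0 : b != 0).
Hypothesis not_fixed : ~ (a ^+ (q ^ 2) = a /\ b ^+ (q ^ 2) = b).
Local Notation a' := (a ^+ (q ^ 2)).
Local Notation b' := (b ^+ (q ^ 2)).
Local Notation C := (conic_at q j x y a b).
Local Notation T := (tangent_at m j x y a b).
Local Notation E := (polar_at m q j x y a b).
Variables (P P' : place j).
Hypotheses (Pab : centered P x y a b) (Pab' : centered P' x y a' b').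
Local Notation v := (place_val P).
Let dP : discrete P := place_discrete mK ff P.
Let dP' : discrete P' := place_discrete mK ff P'.

Let vE : E != 0 /\ v E = 1 := polar_val q1_eq q_eq0 q_ge3 frobL ff ab a0 b0 Pab.
Let vT : T != 0 /\ v T = 2 := tangent_val q1_eq q_eq0 q_ge3 frobL ff ab a0 b0 Pab.
Let vC : C != 0 /\ v C = q%:Z :=
  conic_val q1_eq q_eq0 q_ge3 frobK frobL ff ab a0 b0 Pab
  (not_fixed_nonrational q1_eq frobK ab a0 b0 not_fixed).
Let vC' : C != 0 /\ place_val P' C = 1 :=
  conic_other_val q1_eq q_eq0 q_ge3 frobK frobL ff ab a0 b0 not_fixed Pab'.

Let t' : K := tangent (a ^+ m) (b ^+ m) a b a' b'.
Let t'_neq0 : t' != 0 := tangent_other_neq0 q1_eq frobK ab a0 b0 not_fixed.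
Let T_residue' : residue_at P' T t' := tangent_residue m a b Pab'.

Let polarM : place_ideal P E.
Proof. by case: vE => E0 vE1; apply/(place_val_gt0 dP E0); rewrite vE1. Qed.

Let tangentM : place_ideal P T.
Proof. by case: vT => T0 vT2; apply/(place_val_gt0 dP T0); rewrite vT2. Qed.

Lemma polar_tangent_ring d z : degree_le j E T d z ->
  place_ring P z /\ place_ring P' z.
Proof.
move=> hz; split.
  by apply: degree_le_ring hz; apply: place_ideal_ring.
apply: degree_le_ring hz; last exact: residue_ring T_residue'.
exact: residue_ring (polar_residue m q a b Pab').
Qed.

Lemma ord_ge_conic z : place_ring P z -> ord_ge P q%:Z (C * z).
Proof.
move=> Oz; rewrite mulrC; apply: ord_geMr => //.
by case: vC => C0 vCq; right; rewrite vCq.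
Qed.

(** The square of E is traded for the conic and the tangent. *)
Lemma split_off_conic d z : degree_le j E T d.+1 z ->
  exists c c1 z3 e z2, [/\ degree_le j E T d z3, degree_le j E T e z2 &
    z = j c + j c1 * E + T * z3 + C * z2].
Proof.
case: d => [|d].
  case=> c [_ [_ [[c1 ->] [c2 ->] ->]]]; exists c, c1, (j c2), 0%N, (j 0).
  split; [exact: degree_leC|exact: degree_leC|].
  by rewrite rmorph0 mulr0 addr0 [E * _]mulrC.
case=> c [_ [z2 [[c1 [z3 [z4 [h3 h4 ->]]]] h2 ->]]].
pose k := 4%:R * (a ^+ m * b ^+ m).
exists c, c1, (z2 + E * z4 - j k * z3), d, z3; split=> //.
  apply: degree_leD; first by apply: degree_leD => //; apply: degree_leMs.
  by rewrite -mulNr -rmorphN; apply/degree_leZ/(degree_le_mono _ h3).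
rewrite (conic_atE j x y q1_eq ab a0 b0) -/k; ring.
Qed.

(** Induction on d: the order at P forces the constant and the coefficient of E
    in [split_off_conic] to vanish, and T, which has order 2, can be cancelled. *)
Lemma reduce_mod_conic d z : degree_le j E T d z -> (2 * d <= q)%N ->
  ord_ge P (2 * d)%N%:Z z ->
  exists c e z', degree_le j E T e z' /\ z = j c * T ^+ d + C * z'.
Proof.
elim: d z => [|d IH] z hz dq oz.
  case: hz => c ->; exists c, 0%N, (j 0); split; first exact: degree_leC.
  by rewrite expr0 mulr1 rmorph0 mulr0 addr0.
have [c [c1 [z3 [e [z2 [h3 h2 Ez]]]]]] := split_off_conic hz.
have [O3 _] := polar_tangent_ring h3; have [O2 _] := polar_tangent_ring h2.
have oC := ord_ge_conic O2.
have c_eq0 : c = 0.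
  apply: (@place_ideal_const _ _ _ P).
  have -> : j c = z - j c1 * E - T * z3 - C * z2 by rewrite Ez; ring.
  apply: place_idealB; last by apply/(ord_ge1 dP)/(ord_ge_le _ oC); lia.
  apply: place_idealB; last exact: place_idealMr.
  apply: place_idealB; last exact: place_idealMl (place_ringC _ _) _.
  by apply/(ord_ge1 dP)/(ord_ge_le _ oz); lia.
have oT : ord_ge P 2 (T * z3).
  by rewrite mulrC; apply: ord_geMr => //; case: vT => T0 vT2; right; rewrite vT2.
have c1_eq0 : c1 = 0.
  apply/eqP/contraT => c1n; have [E0 vE1] := vE.
  have : ord_ge P 2 (j c1 * E).
    have -> : j c1 * E = z - T * z3 - C * z2 by rewrite Ez c_eq0 rmorph0; ring.
    apply: ord_geB => //; last by apply: ord_ge_le oC; lia.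
    by apply: ord_geB => //; apply: ord_ge_le oz; lia.
  move/ord_ge_val; rewrite mulf_neq0 ?fmorph_eq0 // => /(_ isT).
  by rewrite place_valM ?fmorph_eq0 // place_valC // vE1.
have {Ez} Ez : z = T * z3 + C * z2.
  by rewrite Ez c_eq0 c1_eq0 !rmorph0 mul0r !add0r.
have [T0 vT2] := vT.
have [|||c' [e' [z' [h' E']]]] := IH z3 => //; first by lia.
  have -> : z3 = (z - C * z2) / T by rewrite Ez addrK mulrC mulKf.
  apply/(ord_ge_div dP) => //; rewrite vT2.
  by apply: ord_geB => //; [apply: ord_ge_le oz|apply: ord_ge_le oC]; lia.
exists c', (e' + e).+1, (T * z' + z2); split.
  apply: degree_leD; last by apply: degree_le_mono h2; lia.
  by apply: degree_leMt; apply: degree_le_mono h'; lia.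
by rewrite Ez E' exprS; ring.
Qed.

Let other_place_neq : P' <> P.
Proof.
move=> e0; have := Pab'; rewrite e0 => /(centered_uniq Pab) [e1 e2].
by apply: not_fixed; rewrite -e1 -e2.
Qed.

Lemma pole_divisorP n f : pole_divisor f = multiple_of_place n P ->
  forall Q, Num.max 0 (- place_val Q f) = if `[< Q = P >] then n%:Z else 0.
Proof. by move=> h Q; have := congr1 (fun D => D Q) h. Qed.

Lemma infinite_neq (Q : place j) w : centered Q x^-1 (y / x) 0 w -> Q <> P.
Proof.
move=> [Mx _] QP; rewrite QP rmorph0 subr0 in Mx.
have [Ox _] := centered_ring Pab.
apply: (@place_ideal1 _ _ _ P); rewrite -(mulVf (transcendental_neq0 ff)).
exact: place_idealMr.
Qed.

Lemma conic_degree_xy : degree_le j x y 2 C.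
Proof.
apply/(degree_le_polar_tangent j x y q1_eq ab a0 b0).
exact: conic_degree.
Qed.

(** With f a function having P as its only pole, of order n, the product
    f C^k is a polynomial of degree at most 2k, of order s at P, that vanishes
    at P'.  By [reduce_mod_conic] it is c T^(2k) modulo C; since T does not
    vanish at P', c = 0 and the order at P is at least q, against s < q. *)
Lemma gap_criterion n k s : (n + s = k * q)%N -> (0 < k)%N -> (4 * k <= s)%N ->
  (s < q)%N -> gaps P n.
Proof.
move=> nsk k0 ks sq [f f0 /pole_divisorP fP].
have n0 : (0 < n)%N by nia.
have vf : v f = - n%:Z.
  by have := fP P; rewrite asboolT // => h; lia.
have OQ Q : Q <> P -> place_ring Q f.
  move=> QP; have := fP Q; rewrite asboolF // => h.
  by apply/(place_val_ge0 (place_discrete mK ff Q) f0); lia.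
have [C0 vCq] := vC; have [_ vC1] := vC'.
pose h := f * C ^+ k.
have h0 : h != 0 by rewrite mulf_neq0 ?expf_neq0.
have vh : v h = s%:Z.
  rewrite place_valM ?expf_neq0 // place_valX // vCq vf -mulr_natr natz.
  by rewrite -PoszM; lia.
have hdeg : degree_le j E T (2 * k) h.
  apply/(degree_le_polar_tangent j x y q1_eq ab a0 b0).
  apply: (regular_degree_le mK ff).
    move=> Q c d Qc; have [QP|QP] := pselect (Q = P).
      by rewrite QP; apply/(place_val_ge0 dP h0); rewrite vh.
    apply: place_ringM; [exact: OQ|apply: place_ringX].
    by have [Ox Oy] := centered_ring Qc; apply: degree_le_ring conic_degree_xy.
  move=> Q w Qw; have OC := degree_le_infinity ff conic_degree_xy Qw.
  have -> : h / x ^+ (2 * k) = f * (C / x ^+ 2) ^+ k.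
    by rewrite /h expr_div_n exprM mulrA.
  by apply: place_ringM; [apply/OQ/(infinite_neq Qw)|apply: place_ringX].
have [||c [e [h' [hdeg' Eh]]]] := reduce_mod_conic hdeg; first by lia.
  by right; rewrite vh; lia.
have [Oh Oh'] := polar_tangent_ring hdeg'.
have MC' : place_ideal P' C by apply/(place_val_gt0 dP' C0); rewrite vC1.
have P'P := other_place_neq.
have c_eq0 : c = 0.
  have M1 : place_ideal P' (j c * T ^+ (2 * k)).
    have -> : j c * T ^+ (2 * k) = h - C * h' by rewrite Eh addrK.
    apply: place_idealB; last exact: place_idealMr.
    rewrite /h; apply: place_idealMl; first exact: OQ.
    exact: place_idealX.
  have := residue_ideal_eq0 (residueM (residueC _ _) (residueX _ T_residue')) M1.
  by move/eqP; rewrite mulf_eq0 expf_eq0 (negPf t'_neq0) andbF orbF => /eqP.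
have : ord_ge P q%:Z h.
  by rewrite Eh c_eq0 rmorph0 mul0r add0r; apply: ord_ge_conic.
by move/(ord_ge_val _ _ h0); rewrite vh lez_nat leqNgt sq.
Qed.

Lemma ex_residue z : place_ring P' z -> exists c, residue_at P' z c.
Proof.
move=> Oz; have b0' : b' != 0 by rewrite expf_neq0.
have Sz : subfield_gen2 (j \o idfun) x y z.
  by have : setT z by []; case: ff => _ _ <-.
exact: (rational_centered mK ff (i := idfun) Pab' b0' Sz Oz).
Qed.

Let x'_val : x - j a' != 0 /\ place_val P' (x - j a') = 1.
Proof.
have b0' : b' != 0 by rewrite expf_neq0.
have [ux _] := discrete_unramified mK ff Pab' b0'.
by split; [apply: XsubC_neq0 ff _|apply: uniformizer_val].
Qed.

Lemma x'_degree : degree_le j E T 1 (x - j a').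
Proof.
apply/(degree_le_polar_tangent j x y q1_eq ab a0 b0); rewrite -rmorphN.
by apply: degree_leD (degree_leC _ _ _ _ _); case: (degree_le_coords j x y).
Qed.

(** C (x - a')^l has order exactly l + 1 at P', so the expansion of h0 at P' can
    be cancelled term by term with multiples of C. *)
Lemma correct_at_other h0 k : place_ideal P' h0 -> (0 < k)%N ->
  exists2 g, degree_le j E T (k - 1) g & ord_ge P' k%:Z (h0 + C * g).
Proof.
move=> Mh0; elim: k => // -[|k] IH _.
  exists (j 0); first exact: degree_leC.
  by rewrite rmorph0 mulr0 addr0; apply/(ord_ge1 dP').
have [//|g hg og] := IH; have [C0 vC1] := vC'; have [t0 vt] := x'_val.
(* x - a' is a uniformizer at P', so w has order k + 1 there *)
pose w := C * (x - j a') ^+ k.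
have w0 : w != 0 by rewrite mulf_neq0 ?expf_neq0.
have vw : place_val P' w = (k.+1)%:Z.
  by rewrite place_valM ?expf_neq0 // place_valX // vC1 vt -mulr_natr natz; lia.
have [|c hc] := @ex_residue ((h0 + C * g) / w).
  by apply/(ord_ge0 dP')/(ord_ge_div dP') => //; rewrite vw add0r.
exists (g - j c * (x - j a') ^+ k).
  apply: degree_leD; first by apply: degree_le_mono hg; lia.
  rewrite -mulNr -rmorphN; apply: degree_leZ.
  apply: degree_le_mono (degree_leX k x'_degree); lia.
have -> : h0 + C * (g - j c * (x - j a') ^+ k) = ((h0 + C * g) / w - j c) * w.
  by rewrite mulrBl divfK // /w; ring.
have -> : (k.+2)%:Z = 1 + (k.+1)%:Z by lia.
apply: ord_geM => //; first by apply/(ord_ge1 dP').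
by right; rewrite vw.
Qed.

(** The required parity of the order is provided by a line through P': the one
    joining it to P, or the parallel to the tangent. *)
Lemma starting_function k s : (s < 4 * k)%N ->
  exists h0, [/\ degree_le j E T (2 * k) h0, h0 != 0, v h0 = s%:Z & place_ideal P' h0].
Proof.
move=> sk; have [E0 vE1] := vE; have [T0 vT2] := vT.
have [hE hT] := degree_le_coords j E T.
pose e' : K := polar (a ^+ q) (b ^+ q) (a ^+ m) (b ^+ m) a' b'.
have [l [hl l0 vl Ml]] : exists l,
    [/\ degree_le j E T 1 l, l != 0, v l = (odd s)%:Z & place_ideal P' l].
  case: (odd s).
    have o : ord_ge P (v E + 1) (- (j (e' / t') * T)).
      rewrite vE1; apply: ord_geN => //; apply: ord_geMr => //;
        first exact: place_ringC.
      by right; rewrite vT2.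
    have [n0 vn] := place_val_add dP E0 o.
    exists (E - j (e' / t') * T); split=> //; last 2 first.
    - by rewrite vn vE1.
    - apply/residue_ideal; rewrite -[X in residue_at _ _ X](subrr e').
      rewrite -[X in residue_at _ _ (_ - X)](divfK t'_neq0 e').
      apply: residueB; first exact: polar_residue Pab'.
      by apply: residueM => //; apply: residueC.
    - apply: degree_leD => //; rewrite -mulNr -rmorphN; exact: degree_leZ.
  have jt0 : - j t' != 0 by rewrite oppr_eq0 fmorph_eq0.
  have o : ord_ge P (v (- j t') + 1) T.
    rewrite -rmorphN place_valC ?oppr_eq0 //.
    by right; rewrite vT2.
  have [n0 vn] := place_val_add dP jt0 o.
  exists (- j t' + T); split=> //; last 2 first.
  - by rewrite vn -rmorphN place_valC ?oppr_eq0.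
  - by rewrite addrC.
  - by apply: degree_leD => //; rewrite -rmorphN; apply: degree_leC.
exists (l * T ^+ s./2); split.
- have := degree_leM hl (degree_leX s./2 hT); apply: degree_le_mono.
  by have := odd_double_half s; lia.
- by rewrite mulf_neq0 ?expf_neq0.
- rewrite place_valM ?expf_neq0 // place_valX // vl vT2.
  by rewrite -{3}(odd_double_half s) -mulr_natr natz -mul2n; lia.
- by apply: place_idealMr => //; apply: place_ringX; apply: residue_ring T_residue'.
Qed.

(** The function is h / C^k with h from [starting_function], corrected at P' by
    [correct_at_other]; the correction has order at least q > s at P. *)
Lemma nongap_criterion n k s : (n + s = k * q)%N -> (0 < k)%N -> (s < 4 * k)%N ->
  (s < q)%N -> weierstrass_semigroup P n.
Proof.
move=> nsk k0 sk sq; have [h0 [hd0 h0n vh0 Mh0]] := starting_function sk.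
have [g hg og] := correct_at_other Mh0 k0.
have [C0 vCq] := vC; have [_ vC1] := vC'; have [Og _] := polar_tangent_ring hg.
have o : ord_ge P (v h0 + 1) (C * g).
  rewrite vh0; apply: (ord_ge_le _ (ord_ge_conic Og)).
  by rewrite -PoszD addn1 lez_nat.
have [hn vh] := place_val_add dP h0n o.
set h := h0 + C * g in og hn vh; rewrite vh0 in vh.
have hdeg : degree_le j x y (2 * k) h.
  apply/(degree_le_polar_tangent j x y q1_eq ab a0 b0).
  apply: (degree_leD hd0); apply: (degree_le_mono (d := 2 + (k - 1))).
    by clear -k0; lia.
  exact: degree_leM (conic_degree _ _ _ q1_eq ab a0 b0) hg.
have f0 : h / C ^+ k != 0 by rewrite mulf_neq0 ?invr_eq0 ?expf_neq0.
exists (h / C ^+ k) => //; apply: funext => Q;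
  rewrite /pole_divisor /multiple_of_place.
have [->|QP] := pselect (Q = P).
  rewrite asboolT // place_valM ?invr_eq0 ?expf_neq0 // place_valV ?expf_neq0 //.
  rewrite place_valX // vh vCq -mulr_natr natz -PoszM mulnC -nsk PoszD.
  clear; lia.
rewrite asboolF //.
suff /(place_val_ge0 (place_discrete mK ff Q) f0) vf : place_ring Q (h / C ^+ k).
  by apply/max_idPl; rewrite oppr_le0.
have [Ox|nOx] := pselect (place_ring Q x); last first.
  have [w [wm Qw]] := centered_infinite mK ff nOx.
  have u := conic_infinite_unit q1_eq frobK ff ab wm Qw.
  have -> : h / C ^+ k = h / x ^+ (2 * k) * (C / x ^+ 2)^-1 ^+ k.
    have x0 := transcendental_neq0 ff.
    by rewrite exprVn expr_div_n -exprM invf_div mulrA mulfVK ?expf_neq0.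
  apply: place_ringM; first exact: (degree_le_infinity ff hdeg Qw).
  by apply: place_ringX; case/ring_unitsE: u.
have [c [d Qc]] := centered_affine mK ff Ox.
have [Ox' Oy'] := centered_ring Qc.
have [cd|cd] := pselect (c = a /\ d = b).
  by case: QP; case: cd Qc => -> -> Qc; apply: (centered_inj mK ff Qc Pab).
have [cd'|cd'] := pselect (c = a' /\ d = b').
  have -> : Q = P' by case: cd' Qc => -> -> Qc; apply: (centered_inj mK ff Qc Pab').
  apply/(ord_ge0 dP')/(ord_ge_div dP'); rewrite ?expf_neq0 //.
  by rewrite place_valX // vC1 add0r -mulr_natr mul1r natz.
have u := conic_affine_unit q1_eq q_eq0 frobK ff ab a0 b0 Qc cd cd'.
apply: place_ringM; first exact: degree_le_ring hdeg.
by rewrite -exprVn; apply: place_ringX; case/ring_unitsE: u.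
Qed.

End WeierstrassSemigroup.

(** * Conclusion *)

Lemma exprDn_of_pchar (R : fieldType) p e : p \in [pchar R] ->
  forall u v : R, (u + v) ^+ (p ^ e) = u ^+ (p ^ e) + v ^+ (p ^ e).
Proof.
move=> pR u v; have pp := pcharf_prime pR; apply: exprDn_pchar.
by rewrite pnatX pnatE // pR.
Qed.

(** The polynomial X^#|F| - X splits over F into distinct linear factors. *)
Lemma frob_fixed_image (F : finFieldType) (K : fieldType)
    (i : {rmorphism F -> K}) (c : K) :
  c ^+ #|F| = c -> exists d, c = i d.
Proof.
move=> cF; have := congr1 (fun p => (map_poly i p).[c]) (finField_genPoly F).
rewrite rmorphB /= map_polyXn map_polyX hornerD hornerN hornerXn hornerX cF subrr.
rewrite rmorph_prod horner_prod => /esym/eqP; rewrite prodf_seq_eq0.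
case/hasP => d _ /=; rewrite map_polyXsubC hornerXsubC subr_eq0 => /eqP.
by exists d.
Qed.

Section NotInO.
Variables (m : nat) (K : closedFieldType) (L : fieldType).
Variables (j : {rmorphism K -> L}) (x y : L).
Hypothesis mK : m%:R != 0 :> K.
Hypothesis ff : fermat_function_field m j x y.

Lemma pole_at_nonring (P : place j) z : ~ place_ring P z -> pole_at P z.
Proof.
move=> nO; have z0 : z != 0 by apply: contra_not_neq nO => ->; apply: place_ring0.
rewrite /pole_at ltNge; apply/negP.
by move/(place_val_ge0 (place_discrete mK ff P) z0).
Qed.

Lemma centered_common_zero (P : place j) a b :
  centered P x y a b -> common_zero P x y a b.
Proof.
have dP := place_discrete mK ff P.
case=> /(place_val_gt0 dP (XsubC_neq0 ff a)) h.
by move=> /(place_val_gt0 dP (XsubC_neq0 (fermat_swap mK ff) b)).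
Qed.

(** A place is at infinity when x is not regular there, and then y is not
    regular either, by symmetry. *)
Lemma centered_notin_O (P : place j) : ~ fermat_O m x y P ->
  exists a b, [/\ centered P x y a b, a != 0 & b != 0].
Proof.
have m0 := exponent_gt0 mK.
move=> nO; have [Ox|nOx] := pselect (place_ring P x); last first.
  case: nO; right; split; first exact: pole_at_nonring.
  apply: pole_at_nonring => Oy; apply: nOx.
  exact: (ring_y mK (fermat_swap mK ff) Oy).
have [a [b Pab]] := centered_affine mK ff Ox; exists a, b.
have cz := centered_common_zero Pab; have ab := centered_curve Pab (fermat_eq ff).
split=> //; apply/negP => /eqP z0; apply: nO; left; rewrite z0 in cz ab.
  exists b; split; last by right.
  by rewrite -ab expr0n eqn0Ngt m0 add0r.
exists a; split; last by left.
by rewrite -ab expr0n eqn0Ngt m0 addr0.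
Qed.

End NotInO.

Lemma zero_nongap (K L : fieldType) (j : {rmorphism K -> L}) (P : place j) :
  (forall Q : place j, discrete Q) -> weierstrass_semigroup P 0%N.
Proof.
move=> dQ; exists 1; first exact: oner_neq0.
apply: funext => Q; rewrite /pole_divisor /multiple_of_place place_val1 //.
by rewrite oppr0 maxxx; case: asboolP.
Qed.

Theorem corollary3p11 (p e q m : nat)
    (F : finFieldType) (K : closedFieldType) (iota : {rmorphism F -> K})
    (L : fieldType) (kappa : {rmorphism K -> L}) (x y : L) (P : place kappa)
    (p_prime : prime p) (e_gt0 : (0 < e)%N) (q_def : q = (p ^ e)%N)
    (two_dvd : (2 %| q + 1)%N) (m_def : m = ((q + 1) %/ 2)%N) (m_ge4 : (4 <= m)%N)
    (cardF : #|F| = (q ^ 2)%N)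
    (closureK : algebraic_closure_of iota)
    (fermatL : fermat_function_field m kappa x y)
    (P_notin_O : ~ fermat_O m x y P)
    (P_not_rational : ~ rational_place iota x y P) :
  gaps P = [set n : nat | exists i j k : nat,
    0 <= m%:Z - 3 - i%:Z - j%:Z - (k * ((q + 1) %/ m))%N%:Z /\
    n = (i + 2 * j + k * q + 1)%N].
Proof.
have q1_eq : q.+1 = (2 * m)%N by rewrite m_def mulnC divnK // addn1.
have q_ge3 : (3 <= q)%N by clear -q1_eq m_ge4; lia.
have pF : p \in [pchar F].
  by apply: (@card_finPcharP _ p (e * 2)) => //; rewrite cardF q_def expnM.
have pK : p \in [pchar K] by rewrite (fmorph_pchar iota).
have pL : p \in [pchar L] by rewrite (fmorph_pchar kappa).
have frobK (u v : K) : (u + v) ^+ q = u ^+ q + v ^+ q.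
  by rewrite q_def; apply: exprDn_of_pchar.
have frobL (u v : L) : (u + v) ^+ q = u ^+ q + v ^+ q.
  by rewrite q_def; apply: exprDn_of_pchar.
have q_eq0 : q%:R = 0 :> K.
  by rewrite q_def natrX (pcharf0 pK) expr0n eqn0Ngt e_gt0.
have mK := m_neq0 q1_eq q_eq0.
have [a [b [Pab a0 b0]]] := centered_notin_O mK fermatL P_notin_O.
have ab := centered_curve Pab (fermat_eq fermatL).
have not_fixed : ~ (a ^+ (q ^ 2) = a /\ b ^+ (q ^ 2) = b).
  rewrite -cardF => -[/(frob_fixed_image iota) [a1 Ea] /(frob_fixed_image iota) [b1 Eb]].
  apply: P_not_rational; rewrite Ea Eb in Pab.
  apply: (rational_centered mK fermatL Pab).
  by rewrite -(fmorph_eq0 iota) -Eb.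
have [P' Pab'] := ex_place mK fermatL (curve_frob2 q1_eq frobK ab).
have gap n k s : (n + s = k * q)%N -> (0 < k)%N -> (4 * k <= s)%N ->
    (s < q)%N -> gaps P n.
  exact: (gap_criterion q1_eq q_eq0 q_ge3 frobK frobL fermatL ab a0 b0
    not_fixed Pab Pab').
have nongap n k s : (n + s = k * q)%N -> (0 < k)%N -> (s < 4 * k)%N ->
    (s < q)%N -> weierstrass_semigroup P n.
  exact: (nongap_criterion q1_eq q_eq0 q_ge3 frobK frobL fermatL ab a0 b0
    not_fixed Pab Pab').
have q1m : ((q + 1) %/ m = 2)%N.
  by rewrite addn1 q1_eq mulnK // (leq_trans _ m_ge4).
(* n = k q - s with 0 <= s < q and k > 0 is a gap exactly when 4 k <= s; below,
   the k of the statement is one less than this k *)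
apply/seteqP; split=> [n Gn|_ [i [l [k [h ->]]]]]; last first.
  rewrite q1m in h; have {}h : (i + l + 2 * k + 3 <= m)%N by clear -h; lia.
  apply: (gap _ k.+1 (q - 1 - i - 2 * l)%N) => //; clear -h q1_eq.
  - by rewrite mulSn; lia.
  - by lia.
  - by lia.
case: n Gn => [|n] Gn.
  by case: Gn; apply: zero_nongap => Q; apply: place_discrete mK fermatL Q.
have q0 : (0 < q)%N by apply: leq_trans q_ge3.
have nE := divn_eq n q; have rq := ltn_pmod n q0.
set k := (n %/ q)%N in nE; set r := (n %% q)%N in nE rq.
have [sk|ks] := ltnP (q - 1 - r) (4 * k.+1).
  case: Gn; apply: (nongap _ k.+1 (q - 1 - r)%N) => //.
    by rewrite nE mulSn; clear -rq; lia.
  by clear -q0; lia.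
exists (r %% 2)%N, (r %/ 2)%N, k; rewrite q1m.
have rE := divn_eq r 2; have r2 := ltn_pmod r (isT : (0 < 2)%N).
by clear -nE rE r2 ks q1_eq rq m_ge4; split; lia.
Qed.
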